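(* Let $d,k\in\mathbb{N}_{+}$, $r_{1},\dots,r_{k}\in\mathbb{N}$, $p$ a prime, and $r:=r_{1}+\dots+r_{k}$. Let $M\colon\mathbb{F}_{p}^{d}\to\mathbb{F}_{p}$ be a quadratic form with $\mathrm{rank}(M)\geq 2r+1$, and let $\Omega\subseteq(\mathbb{F}_{p}^{d})^{k}$ be a consistent $M$-set admitting a standard $M$-representation with dimension vector $(r_{1},\dots,r_{k})$. Then: (i) $|\Omega|=p^{dk-r}(1+O_{k,r}(p^{-1/2}))$; (ii) if $I=\{1,\dots,k'\}$ for some $1\leq k'\leq k-1$, then $\Omega_{I}$ is a consistent $M$-set admitting a standard $M$-representation with dimension vector $(r_{1},\dots,r_{k'})$; moreover, for all but at most $(k-k')r'_{k'}p^{dk'+r'_{k'}-1-\mathrm{rank}(M)}$ many $(n_{i})_{i\in I}\in(\mathbb{F}_{p}^{d})^{k'}$, the set $\Omega_{I}((n_{i})_{i\in I})$ has a standard $M$-representation with dimension vector $(r_{k'+1},\dots,r_{k})$ and $|\Omega_{I}((n_{i})_{i\in I})|=p^{d(k-k')-(r_{k'+1}+\dots+r_{k})}(1+O_{k,r}(p^{-1/2}))$, where $r'_{k'}:=\max_{k'+1\leq i\leq k}r_{i}$; (iii) if $k\geq 2$ and $I\cup J$ is a partition of $\{1,\dots,k\}$ into non-empty sets, then for any $f\colon\Omega\to\mathbb{C}$ with $|f|\leq1$, $$\mathbb{E}_{(n_{1},\dots,n_{k})\in\Omega}f(n_{1},\dots,n_{k})=\mathbb{E}_{(n_{i})_{i\in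 I}\in\Omega_{I}}\mathbb{E}_{(n_{j})_{j\in J}\in\Omega_{I}((n_{i})_{i\in I})}f(n_{1},\dots,n_{k})+O_{k,r}(p^{-1/2}).$$
   Context: A quadratic form is $M(n)=(nA)\cdot n+n\cdot u+v$ on $\mathbb{F}_p^d$ with $A$ symmetric; rank is $\mathrm{rank}(A)$. Elements of $(\mathbb{F}_p^d)^k$ are $(n_1,\dots,n_k)$. An $(M,k)$-integral quadratic function is $F(n_1,\dots,n_k)=\sum_{1\le i\le j\le k}b_{i,j}(n_iA)\cdot n_j+\sum_iv_i\cdot n_i+u$ ($b_{i,j},u\in\mathbb{F}_p$, $v_i\in\mathbb{F}_p^d$); set $v_M(F)=(b_{k,k},b_{k,k-1},\dots,b_{k,1},v_k,b_{k-1,k-1},\dots,b_{k-1,1},v_{k-1},\dots,b_{1,1},v_1,u)$ and $v'_M(F)$ the same vector without $u$. A family $\{F_1,\dots,F_t\}$ (an $(M,k)$-family) is consistent if no linear combination is a nonzero constant function, independent if the $v'_M(F_i)$ are linearly independent. An $M$-set is $\bigcap_iV(F_i)$ ($V$ = zero set) for such a family; consistent if the family can be chosen consistent. An independent $M$-representation of $\Omega$ is an ordered independent family $(F_1,\dots,F_t)$ with $\Omega=\bigcap V(F_i)$; it is standard if the matrix with rows $v_M(F_1),\dots,v_M(F_t)$ is in reduced row echelon form. Then its members can be relabeled $F_{i,j}$, $1\le i\le k$, $1\le j\le r_i$, with $F_{i,j}$ depending nontrivially on $n_i$ and independent of $n_{i+1},\dots,n_k$; $(r_1,\dots,r_k)$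 is its dimension vector. Projections: for $I\subseteq\{1,\dots,k\}$ and polynomial ideals $\mathcal{I},\mathcal{I}',\mathcal{I}''$ of $\mathbb{F}_p[\text{coordinates of }n_1,\dots,n_k]$, $(\mathcal{I}',\mathcal{I}'')$ is an $I$-decomposition of $\mathcal{I}$ if $\mathcal{I}=\mathcal{I}'+\mathcal{I}''$, $\mathcal{I}'\cap\mathcal{I}''=\{0\}$, every polynomial in $\mathcal{I}'$ is independent of $(n_j)_{j\notin I}$, and every nonzero polynomial in $\mathcal{I}''$ depends nontrivially on $(n_j)_{j\notin I}$; finite sets $(\mathcal{J}',\mathcal{J}'')$ form an $I$-decomposition of a finite set $\mathcal{J}$ if the ideals they generate do. If $\Omega=V(\mathcal{J})$ for a consistent $(M,k)$-family $\mathcal{J}$ with $I$-decomposition $(\mathcal{J}_I,\mathcal{J}'_I)$ and $J$ the complement of $I$, then $\Omega_I$ is the set of $(n_i)_{i\in I}\in(\mathbb{F}_p^d)^{|I|}$ at which every $f\in\mathcal{J}_I$ vanishes, and for $(n_i)_{i\in I}$, $\Omega_I((n_i)_{i\in I})$ is the set of $(n_j)_{j\in J}$ with $f(n_1,\dots,n_k)=0$ for all $f\in\mathcal{J}'_I$ (these are independent of the choices made). $O_{k,r}(X)$ denotes a quantity bounded by $K|X|$ with $K$ depending only on $k,r$; $\mathbb{E}_{x\in X}$ is the average over $X$.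
   Formalization: In I-decompositions, ''ideals generated by'' finite sets are read as F_p-linear spans (literal ideals generally admit no decomposition); for p=2, where Ω_I depends on the choice of J, J is taken to be a standard M-representation with dimension vector (r_1,…,r_k). *)

(* Defs.v *)
From HB Require Import structures.
From mathcomp Require Import all_boot all_order all_algebra.
From mathcomp Require Import reals complex.

Set Implicit Arguments.
Unset Strict Implicit.
Unset Printing Implicit Defensive.

Import Order.TTheory GRing.Theory Num.Theory.
Local Open Scope ring_scope.

(* A point (n_1, ..., n_k) of (F_p^d)^k is the k x d matrix whose rows are the
   n_i.  All indices start at 0. *)

Definition dotp (p d : nat) (x y : 'rV['F_p]_d) : 'F_p :=
  \sum_(c < d) x 0 c * y 0 c.

Record quadform (p d : nat) := QuadForm {
  qf_mx : 'M['F_p]_d;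
  qf_lin : 'rV['F_p]_d;
  qf_cst : 'F_p;
  qf_sym : qf_mx^T = qf_mx
}.

Definition qf_eval (p d : nat) (M : quadform p d) (n : 'rV['F_p]_d) : 'F_p :=
  dotp (n *m qf_mx M) n + dotp n (qf_lin M) + qf_cst M.

Definition qf_rank (p d : nat) (M : quadform p d) : nat := \rank (qf_mx M).

(* Pairs (j, i) with i <= j: the larger index comes first, as in the entries
   b_{k,k}, b_{k,k-1}, ..., b_{k,1} of v_M. *)
Definition lowtri (k : nat) : Type := {x : 'I_k * 'I_k | (x.2 <= x.1)%N}.
HB.instance Definition _ k := Finite.on (lowtri k).

(* An (M,k)-integral quadratic function is given by its coefficients b, v, u.
   For p > 2 and qf_rank M > 0 they are determined by the function mq_eval M F
   (and by the corresponding polynomial); for p = 2 they are not, because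
   (n A) . n is then a linear function of n, so v_M only makes sense for the
   coefficient data. *)
Definition mquad (p d k : nat) : Type :=
  ({ffun lowtri k -> ('F_p)^o} * 'M['F_p]_(k, d) * ('F_p)^o)%type.
HB.instance Definition _ (p d k : nat) := Vector.on (mquad p d k).

Section MQuad.
Variables (p d : nat) (M : quadform p d) (k : nat).
Implicit Types (F : mquad p d k) (Fs J : seq (mquad p d k)).
Implicit Types (n : 'M['F_p]_(k, d)) (Omega : {set 'M['F_p]_(k, d)}).

Definition mq_b F : lowtri k -> 'F_p := F.1.1.
Definition mq_v F : 'M['F_p]_(k, d) := F.1.2.
Definition mq_u F : 'F_p := F.2.

Definition mq_eval F n : 'F_p :=
  \sum_(x : lowtri k)
     mq_b F x * dotp (row (val x).2 n *m qf_mx M) (row (val x).1 n)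
  + \sum_(i < k) dotp (row i (mq_v F)) (row i n)
  + mq_u F.

(* The variable n_i occurs in F. *)
Definition mq_depends F (i : 'I_k) : bool :=
  (row i (mq_v F) != 0) ||
  [exists x : lowtri k,
     (mq_b F x != 0) && (((val x).1 == i) || ((val x).2 == i))].

(* b_{k,k}, ..., b_{k,1}, v_k, b_{k-1,k-1}, ..., b_{k-1,1}, v_{k-1}, ...,
   b_{1,1}, v_1 *)
Definition mq_coefs F : seq 'F_p :=
  flatten [seq [seq oapp (mq_b F) 0 (insub (i, j))
                 | j <- rev [seq j : 'I_k <- enum 'I_k | (j <= i)%N]]
               ++ [seq mq_v F i c | c <- enum 'I_d]
            | i <- rev (enum 'I_k)].

Lemma size_mq_coefs F : size (mq_coefs F) = ('C(k.+1, 2) + k * d)%N.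
Proof.
rewrite /mq_coefs size_flatten /shape -map_comp.
rewrite (eq_map (g := fun i : 'I_k => (i.+1 + d)%N)); last first.
  move=> i /=; rewrite size_cat !size_map size_rev -enumT size_enum_ord.
  congr addn.
  rewrite size_filter -(count_map val (fun j => (j <= i)%N)) val_enum_ord.
  rewrite -size_filter -[RHS](size_iota 0); congr size.
  case: i => i /= le_ik; rewrite -(subnKC le_ik) iotaD filter_cat.
  rewrite (all_filterP _); last by apply/allP => j; rewrite mem_iota.
  rewrite (eq_in_filter (a2 := pred0)) ?filter_pred0 ?cats0 // => j.
  by rewrite mem_iota => /andP[lt_ij _]; apply/negbTE; rewrite -ltnNge.
rewrite map_rev sumn_rev sumnE big_map big_enum /= big_split /=.
rewrite sum_nat_const card_ord; congr addn.
by rewrite -(big_mkord xpredT (fun i => i.+1)) -bin2_sum big_nat_recl.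
Qed.

Definition mq_vec' F : 'rV['F_p]_('C(k.+1, 2) + k * d) :=
  \row_c (mq_coefs F)`_c.

Definition mq_vec F : 'rV['F_p]_('C(k.+1, 2) + k * d + 1) :=
  row_mx (mq_vec' F) (mq_u F)%:M.

Definition mq_zeros J : {set 'M['F_p]_(k, d)} :=
  [set n | all (fun F => mq_eval F n == 0) J].

Definition consistent J : Prop :=
  forall (a : 'I_(size J) -> 'F_p) (c : 'F_p),
    (forall n, \sum_(s < size J) a s * mq_eval J`_s n = c) -> c = 0.

Definition independent J : Prop := free [seq mq_vec' F | F <- J].

Definition consistent_Mset Omega : Prop :=
  exists2 J, consistent J & Omega = mq_zeros J.

Definition is_pivot (m N : nat) (B : 'M['F_p]_(m, N)) (i : 'I_m) (j : 'I_N) :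
    Prop :=
  B i j != 0 /\ forall j' : 'I_N, (j' < j)%N -> B i j' = 0.

Definition rref (m N : nat) (B : 'M['F_p]_(m, N)) : Prop :=
  [/\ forall i i' : 'I_m, (i < i')%N -> row i B = 0 -> row i' B = 0,
      forall (i i' : 'I_m) (j j' : 'I_N), (i < i')%N ->
        is_pivot B i j -> is_pivot B i' j' -> (j < j')%N
    & forall (i : 'I_m) (j : 'I_N), is_pivot B i j ->
        B i j = 1 /\ forall i' : 'I_m, i' != i -> B i' j = 0].

(* n_i occurs in F and n_{i+1}, ..., n_k do not *)
Definition mq_top F (i : 'I_k) : bool :=
  mq_depends F i && [forall j : 'I_k, (i < j)%N ==> ~~ mq_depends F j].

(* (F_1, ..., F_t) is an independent family in standard form, in which the
   number of members to be labelled F_{i,1}, F_{i,2}, ... is rs i. *)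
Definition standard Fs (rs : 'I_k -> nat) : Prop :=
  [/\ independent Fs,
      rref (\matrix_(s < size Fs) mq_vec Fs`_s)
    & forall i : 'I_k, count (mq_top^~ i) Fs = rs i].

Definition has_standard_rep Omega (rs : 'I_k -> nat) : Prop :=
  exists2 Fs, standard Fs rs & Omega = mq_zeros Fs.

(* Here "the ideal generated by" a finite set is its F_p-linear span <<_>>, so
   that J' spans the members of <<J>> not involving (n_j)_{j \notin I} and J''
   spans a complement.  Ideals of the polynomial ring cannot be meant: a nonzero
   one contains polynomials involving any given variable, and two nonzero ones
   have a nonzero intersection. *)
Definition I_decomposition (I : {set 'I_k}) J J' J'' : Prop :=
  [/\ (<<J>> = <<J'>> + <<J''>>)%VS,
      (<<J'>> :&: <<J''>> = 0)%VS,
      forall F, F \in <<J'>>%VS -> forall j, j \notin I -> ~~ mq_depends F j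
    & forall F, F \in <<J''>>%VS -> F != 0 ->
        exists2 j, j \notin I & mq_depends F j].

Lemma I_decomposition_exists (I : {set 'I_k}) J :
  exists J' J'', I_decomposition I J J' J''.
Proof.
pose aT := ({ffun lowtri k -> ('F_p)^o} * 'M['F_p]_(k, d))%type.
pose phi F : aT :=
  ([ffun x => (((val x).1 \notin I) || ((val x).2 \notin I))%:R * F.1.1 x],
   \matrix_(i, c) ((i \notin I)%:R * F.1.2 i c)).
have phi_lin : linear phi.
  move=> a F G; congr pair; first by apply/ffunP => x; rewrite !ffunE mulrDr mulrCA.
  by apply/matrixP => i c; rewrite !mxE mulrDr mulrCA.
pose phiL := GRing.isLinear.Build _ _ _ _ phi phi_lin.
pose phil : {linear mquad p d k -> aT} := HB.pack phi phiL.
pose V := lker (linfun phil).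
have phi0 F : reflect (forall j, j \notin I -> ~~ mq_depends F j) (F \in V).
  rewrite memv_ker lfunE /=; apply: (iffP eqP) => [[/ffunP b0 /matrixP v0] j jI|].
    rewrite /mq_depends negb_or negbK; apply/andP; split.
      apply/eqP/rowP => c; have := v0 j c.
      by rewrite !mxE jI mul1r.
    apply/existsPn => x; apply/negP => /andP[/eqP bx0 jx]; apply: bx0.
    have := b0 x; rewrite !ffunE.
    by case/orP: jx => /eqP->; rewrite jI ?orbT mul1r.
  move=> indep; congr pair.
    apply/ffunP => x; rewrite !ffunE.
    case: orP => [xI|_]; last by rewrite mul0r.
    rewrite mul1r; apply/eqP/negPn/negP => bx0.
    by case: xI => /indep/norP[_ /existsPn/(_ x)]; rewrite bx0 eqxx ?orbT.
  apply/matrixP => i c; rewrite !mxE; case: (boolP (i \in I)) => iI.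
    by rewrite mul0r.
  have /norP[/negPn/eqP/rowP/(_ c) + _] := indep i iI.
  by rewrite !mxE mul1r.
exists (vbasis (<<J>> :&: V)), (vbasis (<<J>> :\: V)).
rewrite /I_decomposition !(span_basis (vbasisP _)); split.
- by rewrite addvC addv_diff_cap.
- apply/eqP; rewrite -subv0 -(capv_diff <<J>> V) capvC capvS //.
  exact: capvSr.
- by move=> F; rewrite memv_cap => /andP[_ /phi0].
- move=> F FD F0; case: (boolP [exists j, (j \notin I) && mq_depends F j]).
    by case/existsP => j /andP[jI Fj]; exists j.
  move=> /existsPn noj; suff FV : F \in V.
    by move: F0; rewrite -memv0 -(capv_diff <<J>> V) memv_cap FD FV.
  by apply/phi0 => j jI; have := noj j; rewrite jI.
Qed.

Section Projection.
Variable I : {set 'I_k}.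

(* The point (n_1, ..., n_k) whose coordinates in I (resp. outside I), listed
   in increasing order, are the rows of x (resp. of y). *)
Definition glue (x : 'M['F_p]_(#|I|, d)) (y : 'M['F_p]_(#|~: I|, d)) :
    'M['F_p]_(k, d) :=
  \matrix_(i < k) (\sum_(a < #|I| | enum_val a == i) row a x
                   + \sum_(b < #|~: I| | enum_val b == i) row b y).

Lemma row_glue_in x y (a : 'I_#|I|) : row (enum_val a) (glue x y) = row a x.
Proof.
rewrite rowK (big_pred1 a) => [|b]; last exact: (inj_eq enum_val_inj).
rewrite big_pred0 ?addr0 // => b; apply/negbTE/eqP => eq_ba.
by have := enum_valP b; rewrite eq_ba inE enum_valP.
Qed.

Lemma row_glue_out x y (b : 'I_#|~: I|) :
  row (enum_val b) (glue x y) = row b y.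
Proof.
rewrite rowK addrC (big_pred1 b) => [|a]; last exact: (inj_eq enum_val_inj).
rewrite big_pred0 ?addr0 // => a; apply/negbTE/eqP => eq_ab.
by have := enum_valP b; rewrite -eq_ab inE enum_valP.
Qed.

(* Omega_I, for J' the first part of an I-decomposition: the members of J' do
   not depend on y. *)
Definition proj_set J' : {set 'M['F_p]_(#|I|, d)} :=
  [set x | [forall y, glue x y \in mq_zeros J']].

(* Omega_I(x), for J'' the second part of an I-decomposition *)
Definition fiber_set J'' (x : 'M['F_p]_(#|I|, d)) :
    {set 'M['F_p]_(#|~: I|, d)} :=
  [set y | glue x y \in mq_zeros J''].

End Projection.

End MQuad.

Definition avg (R : realType) (T : finType) (S : {set T}) (f : T -> R[i]) :
    R[i] :=
  (#|S|%:R)^-1 * \sum_(x in S) f x.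

(* Main.v *)
From HB Require Import structures.
Require Import Defs.
From mathcomp Require Import all_boot all_order all_algebra.
From mathcomp Require Import reals complex.
From mathcomp Require Import ring lra.

Set Implicit Arguments.
Unset Strict Implicit.
Unset Printing Implicit Defensive.

Import Order.TTheory GRing.Theory Num.Theory.
Local Open Scope ring_scope.

(** Write F as trace(B n A n^T) + trace(v n^T) + u with C = B + B^T.  Its
    exponential sum, divided by p^(dk), has modulus at most
    p^(- rank(A) rank(C) / 2), since F (n + h) - F n is affine in n with linear
    part C h A; it vanishes when C = 0 and F is not constant.  Summing over the
    span of an independent family of size r gives |Omega| within a factor
    1 + p^(-1/2) of p^(dk - r), for every odd p.

    For odd p the family defining Omega can be recovered from the set: a
    function vanishing on Omega lies in the span.  The crude estimate proves
    this only for p > 3; for p = 3 one uses that three distinct elements of a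
    line in the span cannot all have a symmetric part of rank one, so that a
    fixed proportion of the exponential sums is smaller.

    Standard representations are characterised by the dimensions of the
    intersections of the span with the spaces of functions of n_1, ..., n_c, and
    hence are inherited by projections and, outside an exceptional set, by
    fibres.  A point x is exceptional if some function F of the span loses its
    top variable n_i when restricted to the fibre, which forces a linear
    equation u x A = w with u <> 0; as the condition is homogeneous in F, each
    such x is counted at least p - 1 times.  For p = 2 all the size estimates
    hold trivially by the choice of the constant. *)

(** * Matrix form of integral quadratic functions *)

Section MatrixForm.
Variables (p d : nat) (M : quadform p d).
Local Notation A := (qf_mx M).

Section Fixed.
Variable k : nat.
Implicit Types (F : mquad p d k) (n h : 'M['F_p]_(k, d)).

Definition mq_bmx F : 'M['F_p]_k :=
  \matrix_(i, j) oapp (mq_b F) 0 (insub (i, j)).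

(** The matrix of the polar form of the quadratic part. Its diagonal is twice that of [mq_bmx F], so
    for p = 2 it forgets the coefficients [b_{i,i}]. *)
Definition mq_sym F : 'M['F_p]_k := mq_bmx F + (mq_bmx F)^T.

Lemma mq_bmxE F (x : lowtri k) : mq_bmx F (val x).1 (val x).2 = mq_b F x.
Proof. by rewrite mxE -surjective_pairing valK. Qed.

Lemma mq_bmx_up F (i j : 'I_k) : (i < j)%N -> mq_bmx F i j = 0.
Proof. by move=> ltij; rewrite mxE insubN //= -ltnNge. Qed.

Lemma sum_lowtri F (f : 'I_k -> 'I_k -> 'F_p) :
  \sum_(x : lowtri k) mq_b F x * f (val x).1 (val x).2 =
  \sum_i \sum_j mq_bmx F i j * f i j.
Proof.
rewrite pair_big /=.
under eq_bigr do rewrite -mq_bmxE.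
rewrite [RHS](bigID (fun x : 'I_k * 'I_k => (x.2 <= x.1)%N)) /=.
rewrite [X in _ + X]big1 ?addr0; last first.
  by move=> [i j] /=; rewrite -ltnNge => /mq_bmx_up ->; rewrite mul0r.
rewrite [RHS](reindex_omap (val : lowtri k -> _) insub) /=; last first.
  by move=> x hx; rewrite insubT.
by apply: eq_bigl => x; rewrite valK eqxx (valP x).
Qed.

Lemma mq_symE F (i j : 'I_k) : mq_sym F i j = mq_bmx F i j + mq_bmx F j i.
Proof. by rewrite mxE [_^T _ _]mxE. Qed.

Lemma mq_evalE F n :
  mq_eval M F n = \tr (mq_bmx F *m (n *m A *m n^T)) + \tr (mq_v F *m n^T)
                  + mq_u F.
Proof.
rewrite /mq_eval; congr (_ + _ + _).
  rewrite (sum_lowtri F (fun i j => dotp (row j n *m A) (row i n))).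
  apply: eq_bigr => i _; rewrite mxE; apply: eq_bigr => j _; congr (_ * _).
  rewrite /dotp mxE; apply: eq_bigr => c _.
  by rewrite -row_mul !mxE.
apply: eq_bigr => i _; rewrite mxE; apply: eq_bigr => c _.
by rewrite !mxE.
Qed.

(** Polarisation: symmetry of [A] turns the cross term with [h] on the right into one with the
    transpose of [mq_bmx F], so the two cross terms combine into [mq_sym F]. The last bracket is
    [F h] without its constant term. *)
Lemma mq_evalD F n h :
  mq_eval M F (n + h) =
  mq_eval M F n + \tr (mq_sym F *m h *m A *m n^T) + (mq_eval M F h - mq_u F).
Proof.
rewrite /mq_sym !mq_evalE linearD /= !(mulmxDl, mulmxDr) !mxtraceD.
have -> : \tr (mq_bmx F *m (n *m A *m h^T)) = \tr ((mq_bmx F)^T *m h *m A *m n^T).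
  rewrite -mxtrace_tr !trmx_mul trmxK qf_sym mxtrace_mulC !mulmxA.
  by rewrite mxtrace_mulC !mulmxA mxtrace_mulC !mulmxA.
rewrite !mulmxA; ring.
Qed.

Lemma mq_bmx_is_linear : linear mq_bmx.
Proof.
move=> a F G; apply/matrixP => i j; rewrite !mxE.
by case: insubP => [x _ _|_] /=; rewrite ?mulr0 ?addr0 // /mq_b /= !ffunE.
Qed.

HB.instance Definition _ := GRing.isLinear.Build 'F_p (mquad p d k) 'M['F_p]_k
  _ mq_bmx mq_bmx_is_linear.

Lemma mq_v_is_linear : linear (@mq_v p d k).
Proof. by []. Qed.

HB.instance Definition _ := GRing.isLinear.Build 'F_p (mquad p d k)
  'M['F_p]_(k, d) _ (@mq_v p d k) mq_v_is_linear.

Lemma mq_sym_is_linear : linear mq_sym.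
Proof.
move=> a F G; by rewrite /mq_sym linearP linearP scalerDr addrACA. Qed.

HB.instance Definition _ := GRing.isLinear.Build 'F_p (mquad p d k) 'M['F_p]_k
  _ mq_sym mq_sym_is_linear.

Definition mq_at n F := mq_eval M F n.

Lemma mq_at_is_linear n : linear_for *%R (mq_at n).
Proof.
move=> a F G; rewrite /mq_at !mq_evalE linearP.
have -> : mq_v (a *: F + G) = a *: mq_v F + mq_v G by [].
have -> : mq_u (a *: F + G) = a * mq_u F + mq_u G by [].
rewrite !mulmxDl !mxtraceD -!scalemxAl !mxtraceZ; ring.
Qed.

HB.instance Definition _ n := GRing.isLinear.Build 'F_p (mquad p d k) 'F_p
  *%R (mq_at n) (mq_at_is_linear n).

Lemma mq_eval_add F G n : mq_eval M (F + G) n = mq_eval M F n + mq_eval M G n.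
Proof. exact: (linearD (mq_at n)). Qed.

Lemma mquadP F G : mq_bmx F = mq_bmx G -> mq_v F = mq_v G -> mq_u F = mq_u G ->
  F = G.
Proof.
case: F => [[b v] u]; case: G => [[b' v'] u'] eqb /= eqv equ.
rewrite /mq_v /mq_u /= in eqv equ; rewrite eqv equ; congr (_, _, _).
apply/ffunP => x.
by have := congr1 (fun X : 'M_k => X (val x).1 (val x).2) eqb; rewrite !mq_bmxE.
Qed.

End Fixed.

Section Sub.
Variables (k m : nat) (g : 'I_m -> 'I_k).
Variable z : 'M['F_p]_(k, d).

(* The function y |-> F (z + T^T y), where T^T places the rows of y at the
   positions given by g. *)
Definition mq_sub (F : mquad p d k) : mquad p d m :=
  ([ffun x : lowtri m => mq_bmx F (g (val x).1) (g (val x).2)],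
   rowsub g (mq_v F + mq_sym F *m z *m A), mq_eval M F z).

Lemma mq_sub_is_linear : linear mq_sub.
Proof.
move=> a F G; congr (_, _, _); last exact: (linearP (mq_at z)).
  by apply/ffunP => x; rewrite !ffunE linearP /= !mxE.
rewrite !linearP /= mulmxDl -scalemxAl mulmxDl -scalemxAl.
apply/matrixP => i j; rewrite !mxE; ring.
Qed.

HB.instance Definition _ := GRing.isLinear.Build 'F_p (mquad p d k)
  (mquad p d m) _ mq_sub mq_sub_is_linear.

Hypothesis g_mono : forall a b : 'I_m, (a < b)%N -> (g a < g b)%N.

(** Monotonicity of [g] sends a pair above the diagonal to a pair above the diagonal, where both
    sides vanish. *)
Lemma mq_bmx_sub F : mq_bmx (mq_sub F) = mxsub g g (mq_bmx F).
Proof.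
apply/matrixP => a b; rewrite [LHS]mxE [RHS]mxE.
case: insubP => [x _ eqx|] /=; first by rewrite /mq_b /= ffunE eqx.
by rewrite -ltnNge /= => /g_mono/mq_bmx_up ->.
Qed.

Lemma mq_eval_sub F y :
  mq_eval M (mq_sub F) y = mq_eval M F (z + (rowsub g 1%:M)^T *m y).
Proof.
rewrite addrC mq_evalD !mq_evalE mq_bmx_sub trmx_mul trmxK.
have -> : mq_v (mq_sub F) = rowsub g (mq_v F + mq_sym F *m z *m A) by [].
have -> : mq_u (mq_sub F) = mq_eval M F z by [].
set T := rowsub g 1%:M.
have -> : mxsub g g (mq_bmx F) = T *m mq_bmx F *m T^T.
  rewrite mul_rowsub_mx mul1mx; apply/matrixP => a b; rewrite !mxE.
  rewrite (bigD1 (g b)) //= big1 => [|j /negPf ne_jgb].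
    by rewrite !mxE eqxx mulr1 addr0.
  by rewrite !mxE eq_sym ne_jgb mulr0.
have -> : rowsub g (mq_v F + mq_sym F *m z *m A) =
    T *m (mq_v F + mq_sym F *m z *m A) by rewrite -rowsubE.
rewrite mq_evalE.
have -> : \tr (T *m mq_bmx F *m T^T *m (y *m A *m y^T)) =
    \tr (mq_bmx F *m (T^T *m y *m A *m (y^T *m T))).
  by rewrite -!mulmxA mxtrace_mulC !mulmxA.
have -> : \tr (T *m (mq_v F + mq_sym F *m z *m A) *m y^T) =
    \tr (mq_v F *m (y^T *m T)) + \tr (mq_sym F *m z *m A *m (y^T *m T)).
  by rewrite -mxtraceD -mulmxDl -!mulmxA mxtrace_mulC !mulmxA.
ring.
Qed.

End Sub.
End MatrixForm.

(** * Exponential sums *)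

(** Let [Q'] be a right inverse of [Q] and [L] a left inverse of [col_base A]. Adding [Q' Y L] to a
    solution [x] maps the pairs (x, Y) injectively into all matrices, since [Y] can be read off
    after multiplying by [Q] and [A]. *)
Lemma card_mulmx_fiber (F : finFieldType) (c m d e : nat) (Q : 'M[F]_(c, m))
    (A : 'M[F]_(d, e)) (W : 'M[F]_(c, e)) : row_free Q ->
  (#|[set x : 'M[F]_(m, d) | Q *m x *m A == W]| * #|F| ^ (c * \rank A) <=
   #|F| ^ (m * d))%N.
Proof.
move=> /row_freeP[Q' QQ'].
have /row_fullP[L LA] := col_base_full A.
have /row_freeP[N AN] := row_base_free A.
rewrite -!card_mx -cardsT -cardsX -[leqRHS]cardsT.
pose f (u : 'M[F]_(m, d) * 'M[F]_(c, \rank A)) := u.1 + Q' *m u.2 *m L.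
rewrite -(card_in_imset (f := f)) ?subset_leq_card ?subsetT // => -[x Y] [x' Y'].
rewrite !inE !andbT /= => /eqP Qx /eqP Qx' eqf.
have eqA (z : 'M_(m, d)) Z : Q *m z *m A = W ->
    Q *m (z + Q' *m Z *m L) *m A *m N = W *m N + Z.
  move=> Qz; rewrite mulmxDr !mulmxDl Qz; congr (_ + _).
  have LAN : L *m (A *m N) = 1%:M.
    have -> : A *m N = col_base A *m (row_base A *m N).
      by rewrite mulmxA mulmx_base.
    by rewrite AN mulmx1.
  by rewrite !mulmxA QQ' mul1mx -!mulmxA LAN mulmx1.
have eqY : Y = Y'.
  apply: (@addrI _ (W *m N)); rewrite -(eqA _ _ Qx) -(eqA _ _ Qx').
  by rewrite -[x + _]/(f (x, Y)) eqf.
by move: eqf; rewrite /f eqY /= => /addIr ->.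
Qed.

Section AdditiveCharacter.
Variables (R : rcfType) (p : nat).
Hypothesis p_pr : prime p.

Lemma root_of_unity_neq1 : exists2 w : R[i], w ^+ p = 1 & w != 1.
Proof.
have p_gt1 := prime_gt1 p_pr.
(* The polynomial 1 + X + ... + X^(p-1): its roots are p-th roots of unity, and its value p at 1 is
   nonzero. *)
pose P : {poly R[i]} := \poly_(i < p) 1.
have szP : size P = p by rewrite size_poly_eq ?oner_neq0.
have /closed_rootP[w] : size P != 1%N by rewrite szP neq_ltn p_gt1 orbT.
move=> rootw; exists w.
  apply/eqP; rewrite -subr_eq0 subrX1 mulf_eq0; apply/orP; right.
  move/rootP: rootw; rewrite horner_poly => rw; apply/eqP; rewrite -[RHS]rw.
  by apply: eq_bigr => i _; rewrite mul1r.
apply/eqP => w1; move/rootP: rootw; rewrite w1 horner_poly.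
under eq_bigr do rewrite expr1n mulr1.
rewrite sumr_const card_ord => /eqP; rewrite pnatr_eq0.
by case: p p_gt1.
Qed.

Lemma additive_character : exists e : 'F_p -> R[i],
  [/\ forall x y, e (x + y) = e x * e y, e 0 = 1, forall x, `|e x| = 1 &
      forall x, e x = 1 -> x = 0].
Proof.
have [w wp w1] := root_of_unity_neq1.
have pE := Fp_cast p_pr.
have eD (x y : 'F_p) : w ^+ (x + y : 'F_p)%R = w ^+ x * w ^+ y.
  by rewrite -exprD -[RHS](expr_mod _ wp) /= {3}pE.
have eM (x : 'F_p) j : w ^+ (x *+ j)%R = (w ^+ x) ^+ j.
  elim: j => [|j IH]; first by rewrite mulr0n.
  by rewrite mulrSr eD IH exprSr.
exists (fun x : 'F_p => w ^+ x); split => [||x|x ex1] //.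
- apply/eqP; rewrite -(pexpr_eq1 (prime_gt0 p_pr)) ?normr_ge0 //.
  by rewrite -normrX exprAC wp expr1n normr1.
(* For nonzero [x], raising w^x = 1 to the power x^-1 would give w = 1. *)
- apply/eqP/negPn/negP => x0; case/negP: w1; apply/eqP.
  have : w ^+ (x *+ (x^-1)%R) = 1 by rewrite eM ex1 expr1n.
  rewrite -mulr_natr natr_Zp mulfV //.
Qed.

End AdditiveCharacter.

Section ExpSum.
Variables (R : rcfType) (p : nat) (p_pr : prime p) (e : 'F_p -> R[i]).
Hypotheses (eD : forall x y, e (x + y) = e x * e y) (e0 : e 0 = 1)
  (e_norm : forall x, `|e x| = 1) (e_neq1 : forall x, e x = 1 -> x = 0).

Lemma conj_e x : (e x)^* = e (- x).
Proof.
have ex0 : e x != 0 by rewrite -normr_eq0 e_norm oner_eq0.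
apply: (mulfI ex0); rewrite -normCK e_norm expr1n -eD subrr e0 //.
Qed.

(** Translating the summation variable by [h] multiplies the sum by [e c], which differs from 1. *)
Lemma sum_e_eq0 (T : finZmodType) (f : T -> 'F_p) (h : T) (c : 'F_p) :
  (forall n, f (n + h) = f n + c) -> c != 0 -> \sum_n e (f n) = 0.
Proof.
move=> fh c0; have : (1 - e c) * \sum_n e (f n) = 0.
  rewrite mulrBl mul1r [X in X - _](reindex_inj (addIr h)) /= mulr_sumr.
  rewrite -sumrB big1 // => n _.
  by rewrite fh eD mulrC subrr.
move/eqP; rewrite mulf_eq0 subr_eq0 eq_sym => /orP[/eqP/e_neq1 c00|/eqP //].
by rewrite c00 eqxx in c0.
Qed.

Variables (k d : nat) (M : quadform p d).
Local Notation A := (qf_mx M).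
Implicit Types (F G : mquad p d k) (n h : 'M['F_p]_(k, d)).

Definition expsum F : R[i] := \sum_n e (mq_eval M F n).

Definition nexpsum F : R := Normc.normc (expsum F) / (p ^ (k * d))%:R.

Let q0 : 0 < (p ^ (k * d))%:R :> R.
Proof. by rewrite ltr0n expn_gt0 prime_gt0. Qed.

Lemma norm_expsum F : `|expsum F| = (nexpsum F * (p ^ (k * d))%:R)%:C%C.
Proof. by rewrite /nexpsum divfK ?gt_eqF. Qed.

Lemma nexpsum_ge0 F : 0 <= nexpsum F.
Proof.
rewrite -(pmulr_lge0 _ q0) -lecR -norm_expsum; exact: normr_ge0.
Qed.

Lemma tr_mul_delta_neq0 (X : 'M['F_p]_(k, d)) : X != 0 ->
  exists h, \tr (X *m h^T) != 0.
Proof.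
move=> X0; have /existsP[i /existsP[j Xij]] : [exists i, [exists j, X i j != 0]].
  apply: contraR X0 => /existsPn X0; apply/eqP/matrixP => i j; rewrite mxE.
  by have /existsPn/(_ j) := X0 i; rewrite negbK => /eqP.
exists (delta_mx i j); rewrite trmx_delta /mxtrace (bigD1 i) //=.
rewrite mxE (bigD1 j) //= !mxE !eqxx mulr1 !big1 ?addr0 // => l lne.
  by rewrite mxE big1 // => c _; rewrite mxE (negPf lne) andbF mulr0.
by rewrite mxE (negPf lne) mulr0.
Qed.

Lemma card_matrix_Fp (a b : nat) : #|{: 'M['F_p]_(a, b)}| = (p ^ (a * b))%N.
Proof. by rewrite card_mx card_Fp. Qed.

(** Weyl differencing: the square is the sum over shifts [h] of the sums of [e (F (m + h) - F m)]
    over [m]. The phase is affine in [m] with linear part [C h A], where [C] is [mq_sym F], so only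
    shifts with [C h A = 0] contribute. *)
Lemma sqr_expsum_le F :
  `|expsum F| ^+ 2 <=
  (p ^ (k * d) * #|[set h | mq_sym F *m h *m A == 0]|)%:R.
Proof.
have sqrE : `|expsum F| ^+ 2 =
    \sum_h \sum_m e (mq_eval M F (m + h) - mq_eval M F m).
  rewrite normCK [X in _ * X]rmorph_sum /= mulr_sumr exchange_big /=.
  apply: eq_bigr => m _; rewrite /expsum mulr_suml (reindex_inj (addrI m)) /=.
  by apply: eq_bigr => h _; rewrite conj_e eD.
rewrite -(ger0_norm (exprn_ge0 2 (normr_ge0 (expsum F)))) sqrE.
apply: le_trans (ler_norm_sum _ _ _) _.
rewrite (bigID (fun h => mq_sym F *m h *m A == 0)) /= addrC big1 ?add0r.
  rewrite mulnC natrM -sum1_card big_set natr_sum mulr_suml.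
  apply: ler_sum => h _; apply: le_trans (ler_norm_sum _ _ _) _.
  by rewrite mul1r -card_matrix_Fp -sumr_const ler_sum // => m _; rewrite e_norm.
move=> h /tr_mul_delta_neq0[m' m'0].
apply/eqP; rewrite normr_eq0; apply/eqP.
apply: (sum_e_eq0 (h := m') (c := \tr (mq_sym F *m h *m A *m m'^T))) => // m.
rewrite !(mq_evalD M F _ h) linearD /= mulmxDr mxtraceD; ring.
Qed.

(** The equation [C h A = 0] implies the same equation for [row_base C], which has full row rank, so
    that [card_mulmx_fiber] counts the shifts. *)
Lemma nexpsum_rank F :
  nexpsum F ^+ 2 * (p ^ (\rank (mq_sym F) * \rank A))%:R <= 1.
Proof.
have cardle := card_mulmx_fiber A 0 (row_base_free (mq_sym F)).
rewrite card_Fp // in cardle.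
have {cardle} : (#|[set h : 'M_(k, d) | mq_sym F *m h *m A == 0%R]| *
    p ^ (\rank (mq_sym F) * \rank A) <= p ^ (k * d))%N.
  apply: leq_trans cardle; rewrite leq_mul2r subset_leq_card ?orbT //.
  apply/subsetP => h; rewrite !inE => /eqP Ch0; apply/eqP.
  have /row_fullP[L LC] := col_base_full (mq_sym F).
  have -> : row_base (mq_sym F) =
      L *m (col_base (mq_sym F) *m row_base (mq_sym F)) by rewrite mulmxA LC mul1mx.
  by rewrite mulmx_base -!mulmxA [mq_sym F *m _]mulmxA Ch0 mulmx0.
have := sqr_expsum_le F; rewrite norm_expsum.
set Z := #|_|; set r := (_ * \rank A)%N => le1 le2.
have : (nexpsum F * (p ^ (k * d))%:R) ^+ 2 <= (p ^ (k * d) * Z)%:R.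
  by rewrite -lecR rmorphXn /= rmorph_nat.
rewrite exprMn natrM [X in _ * X <= _]expr2 mulrCA ler_pM2l // => le3.
rewrite -(ler_pM2l q0) mulr1 mulrA [X in X * _]mulrC.
apply: (@le_trans _ _ (Z%:R * (p ^ r)%:R)); last by rewrite -natrM ler_nat.
by rewrite ler_pM2r ?ltr0n ?expn_gt0 ?prime_gt0.
Qed.

(** This says that [v'_M] of [F] is nonzero: a condition on coefficients, not on values. *)
Definition mq_nonconst F := (mq_bmx F != 0) || (mq_v F != 0).

Hypothesis p_odd : p != 2%N.

(** Off the diagonal the entries of [mq_sym F] are those of the triangular matrix [mq_bmx F]; on it
    they are doubled, and 2 is invertible. *)
Lemma mq_sym_eq0 F : mq_sym F = 0 -> mq_bmx F = 0.
Proof.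
move=> C0; apply/matrixP => i j; rewrite [RHS]mxE.
have := congr1 (fun X : 'M_k => X i j) C0; rewrite /= mq_symE [RHS]mxE.
case: (ltngtP i j) => [ltij|ltji|/val_inj ->].
- by rewrite mq_bmx_up.
- by rewrite (mq_bmx_up F ltji) addr0.
- rewrite -mulr2n -mulr_natl => /eqP; rewrite mulf_eq0 => /orP[|/eqP //].
  rewrite -(dvdn_pcharf (pchar_Fp p_pr)) => /(dvdn_leq (isT : 0 < 2)%N).
  by rewrite leqNgt ltn_neqAle eq_sym p_odd prime_gt1.
Qed.

Lemma nexpsum_eq0 F : mq_nonconst F -> mq_sym F = 0 -> nexpsum F = 0.
Proof.
move=> ncF C0; move: ncF; rewrite /mq_nonconst (mq_sym_eq0 C0) eqxx /= => v0.
have [h hv] := tr_mul_delta_neq0 v0.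
suff S0 : expsum F = 0 by rewrite /nexpsum S0 Normc.normc0 mul0r.
rewrite /expsum; apply: (sum_e_eq0 (h := h) _ hv) => m.
have -> : mq_eval M F (m + h) = mq_eval M F m + (mq_eval M F h - mq_u F).
  by rewrite mq_evalD C0 !mul0mx linear0 addr0.
by rewrite (mq_evalE M F h) (mq_sym_eq0 C0) mul0mx linear0 add0r addrK.
Qed.

End ExpSum.

(** * Zero sets of independent families *)

(* Symmetric matrices of rank one are the c v^T v; a sum of two such with
   different v has rank two. *)
Lemma symmetric_rank1_pencil (K : fieldType) (n : nat) (U V : 'M[K]_n) :
  U^T = U -> V^T = V -> U != 0 ->
  (\rank U <= 1)%N -> (\rank V <= 1)%N -> (\rank (U + V)%R <= 1)%N ->
  exists c, V = c *: U.
Proof.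
have minor0 (W : 'M[K]_n) : (\rank W <= 1)%N ->
    forall i j l m, W i j * W l m = W i m * W l j.
  have prod0 r (B : 'M[K]_(n, r)) (N : 'M[K]_(r, n)) : (r <= 1)%N ->
      forall i j l m, (B *m N) i j * (B *m N) l m = (B *m N) i m * (B *m N) l j.
    case: r B N => [|[|//]] B N _ i j l m; rewrite !mxE ?big_ord0 ?mul0r //.
    by rewrite !big_ord1; ring.
  by move=> Wr i j l m; have := prod0 _ (col_base W) (row_base W) Wr i j l m;
    rewrite mulmx_base.
move=> Ut Vt U0 /minor0 mU /minor0 mV /minor0 mUV.
have sU i j : U i j = U j i by rewrite -{1}Ut mxE.
have sV i j : V i j = V j i by rewrite -{1}Vt mxE.
(* If the diagonal of [U] vanished, the relations [U i i * U j j = U i j ^+ 2] would make [U]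
   zero. *)
have /existsP[i Uii] : [exists i, U i i != 0].
  apply: contraR U0 => /existsPn Ud; apply/eqP/matrixP => i j; rewrite mxE.
  have := mU i i j j; have /negPn/eqP -> := Ud i.
  by rewrite mul0r (sU j i) => /esym/eqP; rewrite mulf_eq0 => /orP[]/eqP.
pose c := V i i / U i i; pose W := V - c *: U.
have WE j l : W j l = V j l - c * U j l by rewrite !mxE.
have cE : c * U i i = V i i by rewrite divfK.
(* Subtracting the minors of [U] and of [V] from that of [U + V] leaves a relation bilinear in [U]
   and [V]; inserting [V = c U + W] gives this one. *)
have mW j l : U i i * W j l = U i l * W j i + W i l * U j i.
  have mUV2 : U i i * V j l + V i i * U j l = U i l * V j i + V i l * U j i.
    have := mUV i i j l; rewrite !mxE => mUV'.
    have -> : U i i * V j l + V i i * U j l =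
      (U i i + V i i) * (U j l + V j l) - U i i * U j l - V i i * V j l by ring.
    by rewrite mUV' (mU i i j l) (mV i i j l); ring.
  rewrite !WE mulrBr [RHS](_ : _ = U i l * V j i + V i l * U j i
    - 2 * c * (U i l * U j i)); last by ring.
  rewrite -mUV2 -cE -(mU i i j l); ring.
(* As [W i i = 0] by the choice of [c], the minor of [V] on [i] and [j] reduces, through [mW] and
   the minor of [U], to [W i j ^+ 2 = 0]. *)
have Wi0 j : W i j = 0.
  have := mV i i j j; rewrite -(sV i j).
  have VE l m : V l m = c * U l m + W l m by rewrite WE addrC subrK.
  have Wii : W i i = 0 by rewrite WE cE subrr.
  rewrite !VE Wii addr0 => mVj.
  have := mW j j; rewrite [W j i](_ : _ = W i j); last by rewrite !WE sV sU.
  rewrite (sU j i) => mWj.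
  have : W i j ^+ 2 = 0.
    have mUj := mU i i j j; rewrite (sU j i) in mUj.
    have -> : W i j ^+ 2 = (c * U i j + W i j) * (c * U i j + W i j)
      - c * (c * (U i j * U i j)) - c * (U i j * W i j + W i j * U i j) by ring.
    by rewrite -mUj -mWj -mVj; ring.
  by move/eqP; rewrite expf_eq0 => /eqP.
exists c; apply/matrixP => j l; rewrite [RHS]mxE; apply/eqP.
rewrite -subr_eq0 -WE; apply/eqP/(mulfI Uii).
have Wji : W j i = 0 by rewrite -(Wi0 j) !WE (sV j i) (sU j i).
by rewrite mW Wi0 Wji !mulr0 mul0r addr0.
Qed.

Lemma sqr_add_lt1 (R : realFieldType) (x : R) :
  0 < x -> x ^+ 2 * 3 <= 1 -> x * x + x < 1.
Proof. by move=> x0 x2; nra. Qed.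

Lemma vanishing_sum_lt1 (R : realFieldType) (s : R) : 3 <= s ^+ 2 -> 0 <= s -> 
  2 * (s^-1 * ((s ^+ 2 - 1) + s^-1)) < s ^+ 2.
Proof.
move=> s3 s_ge0.
(* A rational just below sqrt 3. It has to be close: at s = sqrt 3 the numerator
   [s ^+ 4 - 2 * s ^+ 3 + 2 * s - 2] is 7 - 4 sqrt 3, about 0.07. *)
have sgt : 1732/1000 < s by nra.
have s_neq0 : s != 0 by rewrite gt_eqF //; lra.
rewrite -subr_gt0.
have -> : s ^+ 2 - 2 * (s^-1 * ((s ^+ 2 - 1) + s^-1)) =
  (s ^+ 4 - 2 * s ^+ 3 + 2 * s - 2) / s ^+ 2 by field.
rewrite divr_gt0 ?exprn_gt0 //; last lra.
have : 0 < (s - 1732/1000) by lra.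
move: (s - 1732/1000) (subrK (1732/1000) s) => x <- x0.
nra.
Qed.

Section ZeroSets.
Variables (R : rcfType) (p : nat) (p_pr : prime p) (e : 'F_p -> R[i]).
Hypotheses (eD : forall x y, e (x + y) = e x * e y) (e0 : e 0 = 1)
  (e_norm : forall x, `|e x| = 1) (e_neq1 : forall x, e x = 1 -> x = 0).
Variables (k d : nat) (M : quadform p d) (t : nat) (X : 'I_t -> mquad p d k).
Implicit Types (F G : mquad p d k) (a : 'rV['F_p]_t).
Local Notation rho := (qf_rank M).
Local Notation q := (p ^ (k * d))%N.
Local Notation expsum := (expsum e M).
Local Notation nexpsum := (nexpsum e M).

Definition mq_comb a : mquad p d k := \sum_s a 0 s *: X s.

Lemma mq_comb_is_linear : linear mq_comb.
Proof.
move=> c a b; rewrite /mq_comb scaler_sumr -big_split; apply: eq_bigr => s _.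
by rewrite !mxE scalerDl scalerA.
Qed.

HB.instance Definition _ := GRing.isLinear.Build 'F_p 'rV['F_p]_t
  (mquad p d k) _ mq_comb mq_comb_is_linear.

Lemma mq_comb_delta s : mq_comb (delta_mx 0 s) = X s.
Proof.
rewrite /mq_comb (bigD1 s) //= big1 ?addr0 => [|i /negPf nis].
  by rewrite mxE !eqxx scale1r.
by rewrite mxE eqxx nis scale0r.
Qed.

Definition zeros : {set 'M['F_p]_(k, d)} :=
  [set n | [forall s, mq_eval M (X s) n == 0]].

Lemma mq_comb_zeros a n : n \in zeros -> mq_eval M (mq_comb a) n = 0.
Proof.
rewrite inE => /forallP Xn; rewrite -[LHS]/(mq_at M n _) linear_sum big1 // => s _.
by rewrite linearZ /= /mq_at (eqP (Xn s)) mulr0.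
Qed.

Lemma card_rV_Fp : #|{: 'rV['F_p]_t}| = (p ^ t)%N.
Proof. by rewrite card_mx card_Fp // mul1n. Qed.

(** Orthogonality: if [n] is outside [zeros], some [X s] is nonzero at [n], and translating [a]
    along [delta_mx 0 s] kills the sum over [a]; on [zeros] every phase is 0. The summand [F] allows
    cosets of the span. *)
Lemma sum_expsum_comb F : (forall n, n \in zeros -> mq_eval M F n = 0) ->
  \sum_a expsum (mq_comb a + F) = (p ^ t * #|zeros|)%:R.
Proof.
move=> F0; rewrite exchange_big (bigID (fun n => n \in zeros)) /= addrC.
rewrite big1 => [|n].
  rewrite add0r mulnC -sum1_card natrM natr_sum mulr_suml.
  apply: eq_bigr => n nV; rewrite mul1r -card_rV_Fp -sumr_const.
  by apply: eq_bigr => a _; rewrite mq_eval_add mq_comb_zeros // F0 // addr0 e0.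
rewrite inE negb_forall => /existsP[s Xsn].
apply: (sum_e_eq0 eD e_neq1 (h := delta_mx 0 s) _ Xsn) => a.
by rewrite (linearD mq_comb) /= mq_comb_delta !mq_eval_add addrAC.
Qed.

Lemma expsum0 : expsum (0 : mquad p d k) = q%:R.
Proof.
rewrite -(card_matrix_Fp p_pr) -sumr_const; apply: eq_bigr => n _.
by rewrite -[mq_eval _ _ _]/(mq_at M n 0) linear0 e0.
Qed.

Let q0 : 0 < q%:R :> R.
Proof. by rewrite ltr0n expn_gt0 prime_gt0. Qed.

Lemma norm_sum_expsum (T : finType) (P : pred T) (f : T -> mquad p d k) :
  `|\sum_(x | P x) expsum (f x)| <= ((\sum_(x | P x) nexpsum (f x)) * q%:R)%:C%C.
Proof.
apply: le_trans (ler_norm_sum _ _ _) _; rewrite mulr_suml rmorph_sum /=.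
by rewrite ler_sum // => x _; rewrite (norm_expsum p_pr).
Qed.

Lemma card_zeros_dev :
  `|(p ^ t * #|zeros|)%:R / q%:R - 1| <= \sum_(a | a != 0) nexpsum (mq_comb a) :> R.
Proof.
rewrite -(ler_pM2r q0) -{2}(gtr0_norm q0) -normrM mulrBl mul1r divfK ?gt_eqF //.
rewrite -lecR; apply: le_trans (norm_sum_expsum _ _).
have := @sum_expsum_comb 0 (fun n _ => linear0 (mq_at M n)).
under eq_bigr do rewrite addr0.
rewrite (bigD1 0) //= linear0 expsum0 => /(canRL (addKr _)) ->.
rewrite (_ : (`|_|)%:C%C = `|((p ^ t * #|zeros|)%:R - q%:R : R)%:C%C|); last first.
  by rewrite normc_def /= expr0n addr0 sqrtr_sqr.
by rewrite rmorphB /= !rmorph_nat addrC.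
Qed.

(** The sums over the span and over its coset by [F] agree. The term [a = 0] of the first is [q], so
    the remaining terms of both cannot all be small. *)
Lemma vanishing_sum_ge1 F : (forall n, n \in zeros -> mq_eval M F n = 0) ->
  1 <= \sum_(a | a != 0) nexpsum (mq_comb a) + \sum_a nexpsum (mq_comb a + F).
Proof.
move=> F0; rewrite -(ler_pM2r q0) mul1r mulrDl -lecR rmorphD /=.
apply: le_trans (lerD (norm_sum_expsum _ _) (norm_sum_expsum _ _)).
rewrite -[X in _ <= X + _]normrN; apply: le_trans (ler_normD _ _).
have := @sum_expsum_comb 0 (fun n _ => linear0 (mq_at M n)).
under eq_bigr do rewrite addr0.
rewrite (sum_expsum_comb F0) => <-.
rewrite [X in _ + X](bigD1 0) //= linear0 expsum0 addrCA addNr addr0.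
by rewrite rmorph_nat normr_nat.
Qed.

Local Notation s := (Num.sqrt p%:R : R).
Local Notation tau := (s ^- rho).

Let s0 : 0 < s. Proof. by rewrite sqrtr_gt0 ltr0n prime_gt0. Qed.
Let tau0 : 0 < tau. Proof. by rewrite invr_gt0 exprn_gt0. Qed.

(** Here [tau] is p^(-rank(A)/2), the saving of [nexpsum_rank] for each unit of the rank of
    [mq_sym F]. *)
Lemma nexpsum_le_pow F c : (c <= \rank (mq_sym F))%N -> nexpsum F <= tau ^+ c.
Proof.
move=> cr; have ss : s ^+ 2 = p%:R by rewrite sqr_sqrtr ?ler0n.
have nge := nexpsum_ge0 p_pr e M F.
rewrite -(@ler_pXn2r _ 2) ?nnegrE ?exprn_ge0 ?(ltW tau0) //.
have -> : tau ^+ c ^+ 2 = (p%:R ^+ (rho * c))^-1.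
  by rewrite !exprVn -[X in _ = (X ^+ _)^-1]ss -!exprM [(2 * _)%N]mulnC mulnA.
rewrite -(ler_pM2r (x := p%:R ^+ (rho * c))) ?exprn_gt0 ?ltr0n ?prime_gt0 //.
rewrite [X in _ <= X]mulVf; last by rewrite expf_neq0 // pnatr_eq0 -lt0n prime_gt0.
apply: le_trans (nexpsum_rank p_pr eD e0 e_norm e_neq1 M F).
rewrite ler_wpM2l ?exprn_ge0 // -natrX ler_nat leq_pexp2l ?prime_gt0 //.
by rewrite mulnC leq_mul2r cr orbT.
Qed.

Hypothesis p_odd : p != 2%N.

Lemma nexpsum_le F : mq_nonconst F -> nexpsum F <= tau.
Proof.
move=> ncF; have [C0|C0] := eqVneq (mq_sym F) 0.
  by rewrite (nexpsum_eq0 p_pr eD e_neq1) // ltW.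
by apply: (@nexpsum_le_pow F 1); rewrite lt0n mxrank_eq0.
Qed.

Hypothesis X_indep : forall a, a != 0 -> mq_nonconst (mq_comb a).
Hypothesis rank_ge : (2 * t + 1 <= rho)%N.

(** The rank hypothesis enters here: the left side is s^(2t - rho), and 2t - rho is at most -1. *)
Lemma pow_tau_le : (p ^ t)%:R * tau <= s^-1.
Proof.
have s1 : 1 <= s by rewrite -[X in X <= _]sqrtr1 ler_wsqrtr // ler1n prime_gt0.
have ss : s ^+ 2 = p%:R by rewrite sqr_sqrtr ?ler0n.
have ptE : (p ^ t)%:R = s ^+ (2 * t) by rewrite natrX -[X in X ^+ t]ss -exprM.
have -> : s^-1 = (p ^ t)%:R * (s ^+ (2 * t + 1))^-1.
  by rewrite ptE exprD expr1 invfM mulVKf // expf_neq0 ?gt_eqF.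
by rewrite ler_wpM2l ?ler0n // lef_pV2 ?posrE ?exprn_gt0 // ler_weXn2l.
Qed.

Lemma card_zeros_dev_le :
  `|(p ^ t * #|zeros|)%:R / q%:R - 1| <= s^-1.
Proof.
apply: le_trans card_zeros_dev _; apply: le_trans pow_tau_le.
rewrite -card_rV_Fp mulr_natl -sumr_const [X in _ <= X](bigD1 0) //=.
by rewrite ler_wpDl ?(ltW tau0) // ler_sum // => a /X_indep/nexpsum_le.
Qed.

Lemma zeros_neq0 : zeros != set0.
Proof.
apply/eqP => Z0; have := card_zeros_dev_le.
rewrite Z0 cards0 muln0 mul0r sub0r normrN1 invf_ge1 //.
rewrite -[X in _ <= X]sqrtr1 ler_sqrt ?ltr01 // -[1]/(1%:R) ler_nat.
by rewrite leqNgt prime_gt1.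
Qed.


Lemma mq_sym_tr F : (mq_sym F)^T = mq_sym F.
Proof. by rewrite /mq_sym linearD /= trmxK addrC. Qed.

(** A sum above [tau ^+ 2] forces a symmetric part of rank one. If this held along the whole line,
    then [F], [G] and [F + G] would have proportional symmetric parts; some [G + c *: F] would have
    symmetric part 0, and its sum would vanish. *)
Lemma nexpsum_small_on_line F G : tau ^+ 2 < nexpsum F -> mq_nonconst F ->
  (forall c, mq_nonconst (G + c *: F)) ->
  exists c, nexpsum (G + c *: F) <= tau ^+ 2.
Proof.
have big_rank1 (H : mquad p d k) : mq_nonconst H -> tau ^+ 2 < nexpsum H ->
    mq_sym H != 0 /\ (\rank (mq_sym H) <= 1)%N.
  move=> ncH bigH; split.
    apply: contraTneq bigH => C0.
    by rewrite (nexpsum_eq0 p_pr eD e_neq1) // -leNgt exprn_ge0 // ltW.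
  rewrite leqNgt; apply: contraL bigH => r2; rewrite -leNgt.
  exact: nexpsum_le_pow.
move=> bigF ncF ncG; apply/existsP; apply: contraT => /existsPn nosmall.
have {}nosmall c : mq_sym (G + c *: F) != 0 /\
    (\rank (mq_sym (G + c *: F)%R) <= 1)%N.
  by apply: big_rank1 (ncG c) _; rewrite ltNge nosmall.
have [F0 rF] := big_rank1 F ncF bigF.
have [_] := nosmall 0; rewrite scale0r addr0 => rG.
have [_] := nosmall 1; rewrite scale1r linearD addrC /= => rFG.
have [c Gc] := symmetric_rank1_pencil (mq_sym_tr F) (mq_sym_tr G) F0 rF rG rFG.
by have [/eqP[]] := nosmall (- c); rewrite linearD linearZ /= Gc scaleNr subrr.
Qed.

(** The sum is averaged along the direction [a0]: among the p values on each line one obeys the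
    bound [y] and the others the bound [tau]. *)
Lemma sum_lines_le (g : 'rV['F_p]_t -> R) a0 (y : R) :
  (forall a, g a <= tau) -> (forall a, exists c, g (a + c *: a0) <= y) ->
  p%:R * \sum_a g a <= (p ^ t)%:R * ((p%:R - 1) * tau + y).
Proof.
move=> g_le g_line.
have -> : p%:R * \sum_a g a = \sum_a \sum_(c : 'F_p) g (a + c *: a0).
  rewrite exchange_big /= -[X in X%:R * _](card_Fp p_pr) mulr_natl -sumr_const.
  by apply: eq_bigr => c _; rewrite (reindex_inj (addIr (c *: a0))).
rewrite -card_rV_Fp mulr_natl -sumr_const; apply: ler_sum => a _.
have [c gc] := g_line a; rewrite (bigD1 c) //= addrC lerD //.
apply: le_trans (_ : \sum_(c' | c' != c) tau <= _); first exact: ler_sum.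
rewrite sumr_const (_ : #|_| = p.-1); last by rewrite cardC1 card_Fp.
by rewrite -[tau *+ _]mulr_natl -subn1 natrB ?prime_gt0.
Qed.

(** Upper bounds contradict [vanishing_sum_ge1]. If an element of the span has a sum above
    [tau ^+ 2], every line in its direction contains a small term, which saves enough even for p =
    3; otherwise all nonzero elements of the span have small sums. *)
Lemma not_vanishing_on_zeros F : (forall a, mq_nonconst (mq_comb a + F)) ->
  ~ (forall n, n \in zeros -> mq_eval M F n = 0).
Proof.
move=> ncF F0; have := vanishing_sum_ge1 F0.
(* Extended by 0 at the origin, so that lines through it contain a small term as well. *)
pose g1 a := if a == 0 then 0 else nexpsum (mq_comb a).
have -> : \sum_(a | a != 0) nexpsum (mq_comb a) = \sum_a g1 a.
  rewrite [RHS](bigD1 0) //= /g1 eqxx add0r.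
  by apply: eq_bigr => a /negPf ->.
have g1_le a : g1 a <= tau.
  by rewrite /g1; case: eqVneq => [_|/X_indep/nexpsum_le //]; exact: ltW.
have g2_le a : nexpsum (mq_comb a + F) <= tau by exact: nexpsum_le.
have p_ge3 : 3 <= p%:R :> R.
  by rewrite ler_nat ltn_neqAle eq_sym p_odd prime_gt1.
have ss : s ^+ 2 = p%:R by rewrite sqr_sqrtr ?ler0n.
have tau_le : tau <= s^-1.
  apply: le_trans pow_tau_le; rewrite ler_peMl ?(ltW tau0) //.
  by rewrite ler1n expn_gt0 prime_gt0.
have is0 : 0 < s^-1 by rewrite invr_gt0.
have pt_tau := pow_tau_le.
have [/existsP[a0 /andP[a00 a0_big]]|/existsPn small] :=
    boolP [exists a, (a != 0) && (tau ^+ 2 < nexpsum (mq_comb a))].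
(* A bound for p times each of the two sums, from [sum_lines_le] with [y = tau ^+ 2]; the
   contradiction will be [2 * B < p]. *)
- pose B := s^-1 * ((s ^+ 2 - 1) + s^-1).
  have bound : (p ^ t)%:R * ((p%:R - 1) * tau + tau ^+ 2) <= B.
    rewrite /B ss expr2 -mulrDl [(_ + _) * tau]mulrC mulrA.
    apply: le_trans (_ : s^-1 * (p%:R - 1 + tau) <= _); last first.
      by rewrite ler_wpM2l ?(ltW is0) // lerD2l.
    rewrite ler_wpM2r // addr_ge0 ?(ltW tau0) // subr_ge0.
    by rewrite ler1n prime_gt0.
  have line1 : p%:R * \sum_a g1 a <= B.
    apply: le_trans bound; apply: (sum_lines_le (a0 := a0)) g1_le _ => a.
    have [/existsP[c /eqP ac0]|/existsPn ac0] :=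
        boolP [exists c, a + c *: a0 == 0].
      by exists c; rewrite /g1 ac0 eqxx exprn_ge0 // ltW.
    have [c|c cP] := nexpsum_small_on_line a0_big (X_indep a00) (G := mq_comb a).
      by rewrite -linearZ -linearD /= X_indep.
    by exists c; rewrite /g1 (negPf (ac0 c)) linearD linearZ.
  have line2 : p%:R * \sum_a nexpsum (mq_comb a + F) <= B.
    apply: le_trans bound; apply: (sum_lines_le (a0 := a0)) g2_le _ => a.
    have [c|c cP] := nexpsum_small_on_line a0_big (X_indep a00)
        (G := mq_comb a + F).
      by rewrite addrAC -linearZ -linearD.
    by exists c; rewrite linearD linearZ /= addrAC.
  have lt1 : 2 * B < p%:R.
    by rewrite -[X in _ < X]ss vanishing_sum_lt1 ?ss // ltW.
  move=> ge1.
  have : p%:R <= p%:R * (\sum_a g1 a + \sum_a nexpsum (mq_comb a + F)).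
    by rewrite ler_peMr ?ler0n.
  rewrite mulrDr => /le_trans/(_ (lerD line1 line2)).
  by rewrite -mulr2n -[B *+ 2]mulr_natl leNgt lt1.
(* Without a large element the two sums are at most 1/p and p^(-1/2), of total less than 1 once p is
   at least 3. *)
- have sum1 : \sum_a g1 a <= s^-1 * s^-1.
    apply: le_trans (_ : (p ^ t)%:R * tau ^+ 2 <= _); last first.
      by rewrite expr2 mulrA ler_pM ?mulr_ge0 ?ler0n ?(ltW tau0).
    rewrite -card_rV_Fp mulr_natl -sumr_const; apply: ler_sum => a _.
    rewrite /g1; case: eqVneq => [_|a0]; first by rewrite exprn_ge0 // ltW.
    by have := small a; rewrite a0 /= -leNgt.
  have sum2 : \sum_a nexpsum (mq_comb a + F) <= s^-1.
    apply: le_trans pow_tau_le; rewrite -card_rV_Fp mulr_natl -sumr_const.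
    exact: ler_sum.
  have is2 : s^-1 ^+ 2 * 3 <= 1.
    by rewrite exprVn ss mulrC ler_pdivrMr ?mul1r // (lt_le_trans _ p_ge3).
  move/le_trans/(_ (lerD sum1 sum2)); rewrite leNgt.
  by rewrite sqr_add_lt1.
Qed.

End ZeroSets.

(** * Standard families and dimensions *)

Section Positions.
Variables (p d k : nat).
Implicit Types (F G : mquad p d k) (Fs : seq (mquad p d k)) (V : {vspace mquad p d k}).
Local Notation N := ('C(k.+1, 2) + k * d)%N.

(* Positions in v_M: (i, j) for b_{i,j} and (i, c) for the c-th entry of v_i. *)
Definition mq_positions : seq ('I_k * 'I_k + 'I_k * 'I_d) :=
  flatten [seq [seq inl (i, j)
                 | j <- rev [seq j : 'I_k <- enum 'I_k | (j <= i)%N]]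
               ++ [seq inr (i, c) | c <- enum 'I_d]
            | i : 'I_k <- rev (enum 'I_k)].

Definition mq_coef F (x : 'I_k * 'I_k + 'I_k * 'I_d) : 'F_p :=
  match x with inl (i, j) => mq_bmx F i j | inr (i, c) => mq_v F i c end.

(** An entry [b_{i,j}] is filed under its larger index [i], as in [v_M]. *)
Definition block_of (x : 'I_k * 'I_k + 'I_k * 'I_d) : nat :=
  match x with inl (i, _) => i | inr (i, _) => i end.

Definition block (c : nat) : nat := nth 0%N (map block_of mq_positions) c.

Lemma mq_coefs_positions F : mq_coefs F = map (mq_coef F) mq_positions.
Proof.
rewrite /mq_coefs map_flatten -map_comp; congr flatten; apply: eq_map => i /=.
rewrite map_cat -!map_comp; congr cat; apply: eq_map => j //=.
by rewrite mxE.
Qed.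

Lemma size_mq_positions : size mq_positions = N.
Proof.
by rewrite -(size_map (mq_coef 0)) -mq_coefs_positions size_mq_coefs.
Qed.

Lemma block_lt c : (c < N)%N -> (block c < k)%N.
Proof.
rewrite -size_mq_positions => ltc; rewrite /block.
have : nth 0%N (map block_of mq_positions) c \in map block_of mq_positions.
  by rewrite mem_nth // size_map.
by case/mapP => -[[i j]|[i j]] _ ->; exact: ltn_ord.
Qed.

(** The vector [v_M] lists the variables from the last down to the first, so later positions belong
    to smaller indices. *)
Lemma block_anti c c' : (c <= c')%N -> (c' < N)%N -> (block c' <= block c)%N.
Proof.
rewrite -size_mq_positions -(size_map block_of).
have geq_trans : transitive geq by move=> x y z /= yx zy; exact: leq_trans zy yx.
have pw_flatten (g : 'I_k -> seq nat) (s : seq 'I_k) :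
    (forall i x, x \in g i -> x = i) -> pairwise geq (map val s) ->
    pairwise geq (flatten (map g s)).
  move=> gE; elim: s => //= i s IH /andP[si /IH pws].
  rewrite pairwise_cat pws andbT; apply/andP; split.
    apply/allrelP => x y /gE -> /flattenP[_ /mapP[j js ->] /gE ->].
    by move/allP: si => /(_ j); apply; exact: map_f.
  by apply/(pairwiseP 0%N) => a b alt blt _ /=;
    rewrite (gE _ _ (mem_nth _ alt)) (gE _ _ (mem_nth _ blt)).
have : pairwise geq (map block_of mq_positions).
  rewrite /mq_positions map_flatten -map_comp; apply: pw_flatten.
    by move=> i x; rewrite /= map_cat mem_cat -!map_comp => /orP[] /mapP[].
  rewrite map_rev val_enum_ord -sorted_pairwise // rev_sorted.
  by apply: sub_sorted (iota_sorted 0 k) => x y.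
move=> /(pairwiseP 0%N) pw lecc ltc.
move: lecc; rewrite leq_eqVlt => /orP[/eqP -> //|ltcc].
by apply: pw; rewrite ?inE //; exact: ltn_trans ltcc ltc.
Qed.

(** Since [b_{i,j}] sits in block [i >= j], the blocks from [c] on contain exactly the coefficients
    of the terms involving a variable of index at least [c]. *)
Lemma block_vanishP F (c : nat) :
  (forall x, (x < N)%N -> (c <= block x)%N -> (mq_coefs F)`_x = 0) <->
  (forall i : 'I_k, (c <= i)%N -> ~~ mq_depends F i).
Proof.
rewrite mq_coefs_positions; split=> [coef0 i lei|indep x ltx lex].
  have {}coef0 y : y \in mq_positions -> (c <= block_of y)%N -> mq_coef F y = 0.
    move=> yP ley; have := coef0 (index y mq_positions).
    rewrite -size_mq_positions index_mem yP /block !(nth_map y) ?index_mem //.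
    by rewrite nth_index // => /(_ isT ley).
  apply/norP; split.
    rewrite negbK; apply/eqP/rowP => j; rewrite !mxE.
    apply: (coef0 (inr (i, j))) => //; apply/flattenP; eexists.
      by apply: (map_f _ (x := i)); rewrite mem_rev mem_enum.
    by rewrite mem_cat map_f ?orbT ?mem_enum.
  apply/existsPn => x; apply/negP => /andP[/negP bx0 xi]; apply: bx0; apply/eqP.
  rewrite -mq_bmxE; apply: (coef0 (inl ((val x).1, (val x).2))) => /=.
    apply/flattenP; eexists.
      by apply: (map_f _ (x := (val x).1)); rewrite mem_rev mem_enum.
    rewrite mem_cat (_ : inl _ \in _) //; apply: map_f.
    by rewrite mem_rev mem_filter mem_enum (valP x).
  case/orP: xi => /eqP eqi; first by rewrite eqi.
  by apply: leq_trans (valP x); rewrite eqi.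
rewrite -size_mq_positions in ltx.
have x0 : 'I_k * 'I_k + 'I_k * 'I_d by case: (mq_positions) ltx.
move: lex; rewrite /block !(nth_map x0) //.
case: (nth x0 _ x) => -[i j] /= lei;
  have /norP[/negPn/eqP vi /existsPn bi] := indep i lei.
  rewrite mxE; case: insubP => [y _ yE|] //=.
  by have := bi y; rewrite yE eqxx andbT negbK => /eqP.
by have := congr1 (fun u : 'rV_d => u 0 j) vi; rewrite !mxE.
Qed.

Lemma mq_coefs_linear c a F G :
  (mq_coefs (a *: F + G))`_c = a * (mq_coefs F)`_c + (mq_coefs G)`_c.
Proof.
rewrite !mq_coefs_positions.
have [ltc|gec] := ltnP c (size mq_positions); last first.
  by rewrite !nth_default ?size_map // mulr0 addr0.
have x0 : 'I_k * 'I_k + 'I_k * 'I_d by case: (mq_positions) ltc.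
by rewrite !(nth_map x0) //; case: (nth x0 _ c) => -[i j] /=;
  rewrite linearP !mxE.
Qed.

Definition mq_nth c F : 'F_p := (mq_coefs F)`_c.

Lemma mq_nth_is_linear c : linear_for *%R (mq_nth c).
Proof. by move=> a F G; exact: mq_coefs_linear. Qed.

HB.instance Definition _ c := GRing.isLinear.Build 'F_p (mquad p d k) 'F_p
  *%R (mq_nth c) (mq_nth_is_linear c).

Definition mq_mask (m : pred nat) F : 'rV['F_p]_N :=
  \row_(c < N) (if m c then mq_nth c F else 0).

Lemma mq_mask_is_linear m : linear (mq_mask m).
Proof.
move=> a F G; apply/rowP => c; rewrite !mxE; case: ifP => _.
  by rewrite linearP.
by rewrite mulr0 addr0.
Qed.

HB.instance Definition _ m := GRing.isLinear.Build 'F_p (mquad p d k)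
  'rV['F_p]_N _ (mq_mask m) (mq_mask_is_linear m).

End Positions.

HB.lock Definition mask_space (p d k : nat) (m : pred nat) :
    {vspace mquad p d k} :=
  lker (linfun (@mq_mask p d k m)).

(** * Reduced echelon bases and the filtration by the variables involved *)

Section Standard.
Variables (p d k : nat).
Implicit Types (F G : mquad p d k) (Fs : seq (mquad p d k)) (V : {vspace mquad p d k}).
Local Notation N := ('C(k.+1, 2) + k * d)%N.
Local Notation mask_space := (mask_space p d k).
Local Notation block := (block d k).

Lemma mask_spaceP (m : pred nat) F :
  reflect (forall c, (c < N)%N -> m c -> mq_nth c F = 0) (F \in mask_space m).
Proof.
rewrite unlock memv_ker lfunE /=; apply: (iffP eqP) => [/rowP F0 c ltc mc|F0].
  by have := F0 (Ordinal ltc); rewrite !mxE /= mc.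
by apply/rowP => c; rewrite !mxE; case: ifP => // mc; exact: F0.
Qed.

(* The functions not depending on the variables with index at least c. *)
Definition below (c : nat) := mask_space (fun x => (c <= block x)%N).

Lemma belowP c F :
  reflect (forall i : 'I_k, (c <= i)%N -> ~~ mq_depends F i) (F \in below c).
Proof.
by apply: (iffP (mask_spaceP _ _)) => /block_vanishP.
Qed.

Lemma mq_topE F (i : 'I_k) :
  mq_top F i = (F \in below i.+1) && (F \notin below i).
Proof.
apply/andP/andP => -[].
  move=> Fi /forallP Fgt; split; first by apply/belowP => j; exact/implyP.
  by apply/negP => /belowP/(_ i (leqnn i)); rewrite Fi.
move=> /belowP Fgt nFi; split; last by apply/forallP => j; apply/implyP/Fgt.
apply: contraNT nFi => nFi; apply/belowP => j.
rewrite leq_eqVlt => /orP[/eqP/val_inj <- //|]; exact: Fgt.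
Qed.


(** Reduced row echelon form with its pivot columns [ps] made explicit. Pivots lie in the first [N]
    columns, never in that of [u], which reflects independence of the [v'_M]. *)
Definition echelon Fs (ps : seq nat) : Prop :=
  [/\ size ps = size Fs, sorted ltn ps,
      forall i, (i < size Fs)%N -> ((nth 0%N ps i) < N)%N,
      forall i c, (i < size Fs)%N -> (c < (nth 0%N ps i))%N -> mq_nth c Fs`_i = 0
    & forall i j, (i < size Fs)%N -> (j < size Fs)%N ->
        mq_nth (nth 0%N ps i) Fs`_j = (i == j)%:R].

Lemma mem_span_nth Fs F : F \in <<Fs>>%VS ->
  exists a : 'I_(size Fs) -> 'F_p, F = \sum_i a i *: Fs`_i.
Proof.
move=> FF; exists (fun i => coord (in_tuple Fs) i F).
exact: (coord_span (X := in_tuple Fs) FF).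
Qed.

Lemma echelon_coord Fs ps F : echelon Fs ps -> F \in <<Fs>>%VS ->
  F = \sum_(i < size Fs) mq_nth (nth 0%N ps i) F *: Fs`_i.
Proof.
move=> [_ _ _ _ delta] /mem_span_nth[a FE].
rewrite {1}FE; apply: eq_bigr => i _; congr (_ *: _); rewrite FE linear_sum.
rewrite (bigD1 i) //= big1 => [|j ji].
  by rewrite addr0 linearZ /= delta // eqxx mulr1.
by rewrite linearZ /= delta // eq_sym (inj_eq val_inj) (negPf ji) mulr0.
Qed.

Lemma echelon_free Fs ps : echelon Fs ps -> free Fs.
Proof.
move=> [_ _ _ _ delta]; apply/(freeP (X := in_tuple Fs)) => a sum0 i.
have := congr1 (mq_nth (nth 0%N ps i)) sum0; rewrite linear0 linear_sum (bigD1 i) //=.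
rewrite big1 => [|j ji].
  by rewrite addr0 linearZ /= delta // eqxx mulr1.
by rewrite linearZ /= delta // eq_sym (inj_eq val_inj) (negPf ji) mulr0.
Qed.

(** Blocks decrease along [v_M], so the pivot, being the first nonzero entry, lies in the largest
    block that occurs. *)
Lemma echelon_below Fs ps i c : echelon Fs ps -> (i < size Fs)%N ->
  (Fs`_i \in below c) = (block (nth 0%N ps i) < c)%N.
Proof.
move=> [_ _ ltN lead delta] lti; apply/mask_spaceP/idP => [F0|ltc x ltx lex].
  rewrite ltnNge; apply/negP => lec.
  have := F0 _ (ltN i lti) lec.
  by rewrite delta // eqxx => /eqP; rewrite oner_eq0.
apply: lead => //; rewrite ltnNge; apply/negP => lepx.
by have := leq_ltn_trans (leq_trans lex (block_anti p lepx ltx)) ltc; rewrite ltnn.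
Qed.

(** Coordinates in an echelon family are read at the pivots. An element of [below c] has coordinate
    0 at every pivot in a block at least [c], so the members lying in [below c] span the
    intersection. *)
Lemma dim_span_below Fs ps c : echelon Fs ps ->
  \dim (<<Fs>> :&: below c) = count (fun x => block x < c)%N ps.
Proof.
move=> ech; have [szps _ ltN _ _] := ech.
pose X := [seq F <- Fs | F \in below c].
have -> : (<<Fs>> :&: below c)%VS = <<X>>%VS.
  apply/eqP; rewrite eqEsubv; apply/andP; split.
    apply/subvP => F; rewrite memv_cap => /andP[FV Fc].
    rewrite (echelon_coord ech FV); apply: memv_suml => i _.
    have [ltc|lec] := ltnP (block (nth 0%N ps i)) c.
      by apply/memvZ/memv_span; rewrite mem_filter (echelon_below c ech) ?ltc ?mem_nth.
    by rewrite (mask_spaceP _ _ Fc) ?scale0r ?mem0v // ltN.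
  apply/span_subvP => F; rewrite mem_filter => /andP[Fc FF].
  by rewrite memv_cap Fc memv_span.
have /eqP -> := filter_free (fun F => F \in below c) (echelon_free ech).
rewrite size_filter -[in LHS](mkseq_nth 0 Fs) -[in RHS](mkseq_nth 0%N ps).
rewrite !count_map szps; apply: eq_in_count => i; rewrite mem_iota => lti /=.
by rewrite (echelon_below c ech).
Qed.

Lemma echelon_count_top Fs ps (i : 'I_k) : echelon Fs ps ->
  count (fun F => mq_top F i) Fs = count (fun x => block x == i) ps.
Proof.
move=> ech; have [szps _ _ _ _] := ech.
rewrite -[in LHS](mkseq_nth 0 Fs) -[in RHS](mkseq_nth 0%N ps) !count_map szps.
apply: eq_in_count => j; rewrite mem_iota => ltj /=.
by rewrite mq_topE !(echelon_below _ ech) // ltnS -leqNgt -eqn_leq.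
Qed.

Lemma dim_below_top Fs ps c : echelon Fs ps ->
  \dim (<<Fs>> :&: below c) =
  (\sum_(i < k | i < c) count (fun F => mq_top F i) Fs)%N.
Proof.
move=> ech; rewrite (dim_span_below c ech).
under eq_bigr do rewrite (echelon_count_top _ ech).
have [szps _ ltN _ _] := ech.
have {}ltN x : x \in ps -> (block x < k)%N.
  move=> xps; apply: (block_lt p); rewrite -(nth_index 0%N xps); apply: ltN.
  by rewrite -szps index_mem.
elim: ps {ech szps} ltN => [|x ps IH] ltN /=; first by rewrite big1.
rewrite big_split /= -IH => [|y yps]; last by apply: ltN; rewrite inE yps orbT.
congr addn; have ltx := ltN x (mem_head _ _).
rewrite big_mkcond (bigD1 (Ordinal ltx)) //= eqxx big1 ?addn0 => [|i ix].
  by case: ltnP.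
case: ifP => // _; rewrite [_ == _]eq_sym -(inj_eq val_inj) in ix *.
by rewrite (negPf ix).
Qed.

(** Independence of the [v'_M] gives each row a nonzero entry before the column of [u], hence a
    pivot among the first [N] columns. *)
Lemma standard_echelon Fs rs : standard Fs rs -> exists ps, echelon Fs ps.
Proof.
move=> [indep [_ incr piv] _].
pose B := \matrix_(s < size Fs) mq_vec Fs`_s.
have BE (s : 'I_(size Fs)) c (ltc : (c < N)%N) :
    B s (lshift 1 (Ordinal ltc)) = mq_nth c Fs`_s.
  by rewrite mxE row_mxEl mxE.
pose lead F := find (fun x => x != 0) (mq_coefs F).
have lead_has F : F \in Fs -> has (fun x => x != 0) (mq_coefs F).
  move=> FF; have := free_not0 indep (map_f _ FF).
  apply: contraR => /hasPn F0; apply/eqP/rowP => c; rewrite !mxE.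
  apply/eqP/negPn/F0/mem_nth; rewrite size_mq_coefs; exact: ltn_ord.
have lead_lt F : F \in Fs -> (lead F < N)%N.
  by move=> /lead_has; rewrite has_find size_mq_coefs.
have nthF (s : 'I_(size Fs)) : Fs`_s \in Fs by exact: mem_nth.
have leadP (s : 'I_(size Fs)) :
    is_pivot B s (lshift 1 (Ordinal (lead_lt _ (nthF s)))).
  split; first by rewrite BE; exact: nth_find (lead_has _ (nthF s)).
  move=> c /= ltc; have ltN : (c < N)%N by exact: ltn_trans ltc (lead_lt _ (nthF s)).
  have -> : c = lshift 1 (Ordinal ltN) by exact: val_inj.
  by rewrite BE; apply/eqP/negPn/negbT; exact: (before_find 0 ltc).
exists (map lead Fs); split; rewrite ?size_map //.
- apply/(sortedP 0%N) => i; rewrite size_map => lti.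
  have lti' := ltnW lti; rewrite !(nth_map 0) //.
  exact: (incr (Ordinal lti') (Ordinal lti) _ _ _ (leadP _) (leadP _)).
- by move=> i lti; rewrite (nth_map 0) // lead_lt // mem_nth.
- move=> i c lti; rewrite (nth_map 0) // => ltc.
  by apply/eqP/negPn/negbT; exact: (before_find 0 ltc).
- move=> i j lti ltj; rewrite (nth_map 0) //.
  have [Bii Bji] := piv _ _ (leadP (Ordinal lti)).
  have [<-|ne_ij] := eqVneq i j; first by rewrite BE in Bii.
  by have := Bji (Ordinal ltj); rewrite BE; apply; rewrite -(inj_eq val_inj) /= eq_sym.
Qed.

Lemma echelon_standard Fs ps : echelon Fs ps ->
  standard Fs (fun i => count (fun F => mq_top F i) Fs).
Proof.
move=> ech; have [szps ltps ltN lead delta] := ech.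
pose B := \matrix_(s < size Fs) mq_vec Fs`_s.
have BE (s : 'I_(size Fs)) c (ltc : (c < N)%N) :
    B s (lshift 1 (Ordinal ltc)) = mq_nth c Fs`_s.
  by rewrite mxE row_mxEl mxE.
have ltN' (s : 'I_(size Fs)) : (nth 0%N ps s < N)%N by exact: ltN.
pose P s := lshift 1 (Ordinal (ltN' s)).
have BP s : B s (P s) = 1 by rewrite BE delta // eqxx.
have PE s j : is_pivot B s j -> j = P s.
  move=> [Bsj Bs0]; apply: val_inj; case: (ltngtP j (P s)) => // lt.
    have ltjN : (j < N)%N by exact: ltn_trans lt (ltN' s).
    case/eqP: Bsj; have -> : j = lshift 1 (Ordinal ltjN) by exact: val_inj.
    by rewrite BE lead.
  by have := Bs0 _ lt; rewrite BP => /eqP; rewrite oner_eq0.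
split=> //.
- rewrite /independent; set L := map _ _.
  have szL : size L = size Fs by rewrite size_map.
  apply/(freeP (X := in_tuple L)) => a sum0 i.
  have lti : (i < size Fs)%N by rewrite -szL.
  have := congr1 (fun u : 'rV_N => u 0 (Ordinal (ltN _ lti))) sum0.
  rewrite mxE summxE (bigD1 i) //= big1 => [|j ji].
    by rewrite addr0 (nth_map 0) // !mxE -/(mq_nth _ _) delta // eqxx mulr1.
  have ltj : (j < size Fs)%N by rewrite -szL.
  rewrite mxE (nth_map 0) // mxE -/(mq_nth _ _) delta //.
  by rewrite eq_sym (inj_eq val_inj) (negPf ji) mulr0.
- split.
  + move=> i i' _ Bi0; have := congr1 (fun u : 'rV_(N + 1) => u 0 (P i)) Bi0.
    by rewrite [LHS]mxE [RHS]mxE BP => /eqP; rewrite oner_eq0.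
  + move=> i i' j j' ltii /PE -> /PE -> /=.
    by apply: (sorted_ltn_nth ltn_trans 0%N ltps); rewrite ?inE ?szps.
  + move=> i j /PE ->; split=> [|i' ne]; first exact: BP.
    by rewrite BE delta // eq_sym (inj_eq val_inj) (negPf ne).
Qed.

Lemma echelon_exists V : (V :&: below 0 = 0)%VS ->
  exists Fs ps, echelon Fs ps /\ <<Fs>>%VS = V.
Proof.
move=> V0.
(* Gaussian elimination from the last position backwards: at stage [j] the family spans the elements
   of [V] that vanish at all positions before [j]. For [j = N] these are constants, hence 0 by
   hypothesis. *)
suff gen n j : (j + n = N)%N -> exists Fs ps, [/\ echelon Fs ps,
    forall x, x \in ps -> (j <= x)%N, {subset Fs <= V} &
    forall F, F \in V -> (forall c, (c < j)%N -> mq_nth c F = 0) -> F \in <<Fs>>%VS].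
  have [Fs [ps [ech _ FsV VFs]]] := gen N 0%N (add0n _).
  exists Fs, ps; split=> //; apply/eqP; rewrite eqEsubv; apply/andP; split.
    by apply/span_subvP => F /FsV.
  by apply/subvP => F FV; apply: VFs => // c; rewrite ltn0.
elim: n j => [|n IH] j.
  rewrite addn0 => jN; exists [::], [::]; split=> // F FV F0.
  suff : F \in (V :&: below 0)%VS by rewrite V0 memv0 => /eqP ->; exact: mem0v.
  by rewrite memv_cap FV; apply/mask_spaceP => c ltc _; apply: F0; rewrite jN.
rewrite -addSnnS => jn.
have [Fs [ps [ech psj FsV VFs]]] := IH j.+1 jn.
have ltjN : (j < N)%N by rewrite -jn leq_addr.
have [szps ltps ltN lead delta] := ech.
pose Z j' := (V :&: mask_space (fun c => c < j')%N)%VS.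
have ZP j' F : (j' <= N)%N -> F \in Z j' <->
    F \in V /\ forall c, (c < j')%N -> mq_nth c F = 0.
  move=> lej; rewrite memv_cap; split=> [/andP[-> /mask_spaceP F0]|[-> F0] /=].
    by split=> // c ltc; apply: F0 => //; exact: leq_trans ltc lej.
  by apply/mask_spaceP => c _; exact: F0.
have [/subvP ZZ|/subvPn[F /(ZP _ _ (ltnW ltjN))[FV F0] FnZ]] :=
    boolP (Z j <= Z j.+1)%VS.
  exists Fs, ps; split=> // [x /psj /ltnW //|F FV F0].
  have /ZZ/(ZP _ _ ltjN)[_] : F \in Z j by apply/ZP => //; exact: ltnW.
  exact: VFs.
have Fj : mq_nth j F != 0.
  apply: contra FnZ => /eqP Fj; apply/(ZP _ _ ltjN); split=> // c.
  by rewrite ltnS leq_eqVlt => /orP[/eqP -> //|]; exact: F0.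
have [F1 [F1V F1j F1lt]] : exists F1, [/\ F1 \in V, mq_nth j F1 = 1 &
    forall c, (c < j)%N -> mq_nth c F1 = 0].
  exists ((mq_nth j F)^-1 *: F); split; first exact: memvZ.
    by rewrite linearZ /= mulVf.
  by move=> c ltc; rewrite linearZ /= (F0 c ltc) mulr0.
(* The pivots found so far lie beyond [j], so clearing them leaves the entries up to [j]
   unchanged. *)
pose G := F1 - \sum_(i < size Fs) mq_nth (nth 0%N ps i) F1 *: Fs`_i.
have psj' i : (i < size Fs)%N -> (j < nth 0%N ps i)%N.
  by move=> lti; apply/psj/mem_nth; rewrite szps.
have Gc c : (c <= j)%N -> mq_nth c G = mq_nth c F1.
  move=> lec; rewrite /G linearB linear_sum /= big1 ?subr0 // => i _.
  rewrite linearZ /= lead ?mulr0 //; exact: leq_ltn_trans lec (psj' i _).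
have Gj : mq_nth j G = 1 by rewrite Gc.
have Glt c : (c < j)%N -> mq_nth c G = 0.
  by move=> ltc; rewrite Gc ?(ltnW ltc) // F1lt.
have GV : G \in V.
  apply: memvB => //.
  by apply: memv_suml => i _; apply/memvZ/FsV/mem_nth.
have Gps i : (i < size Fs)%N -> mq_nth (nth 0%N ps i) G = 0.
  move=> lti; rewrite /G linearB linear_sum (bigD1 (Ordinal lti)) //= big1.
    by rewrite addr0 linearZ /= delta // eqxx mulr1 subrr.
  move=> l ne; rewrite linearZ /= delta // eq_sym.
  by move: ne; rewrite -(inj_eq val_inj) /= => /negPf ->; rewrite mulr0.
exists (G :: Fs), (j :: ps); split.
- split=> //=.
  + by rewrite szps.
  + rewrite path_min_sorted //; apply/allP => x /psj //.
  + by case.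
  + by case=> [|i] c //= => [_|]; [exact: Glt | exact: lead].
  + case=> [|i] [|l] //= lti ltl.
    * exact: lead (psj' _ _).
    * by rewrite Gps.
    * by rewrite delta.
- by move=> x; rewrite inE => /orP[/eqP -> //|/psj/ltnW].
- by move=> H; rewrite inE => /orP[/eqP ->|/FsV].
- move=> H HV H0; rewrite -[H](subrK (mq_nth j H *: G)).
  apply: memvD; last by apply/memvZ/memv_span/mem_head.
  apply: subvP (sub_span _) _ _; first by move=> x xF; rewrite inE xF orbT.
  apply: VFs; first by apply: memvB => //; exact: memvZ.
  move=> c; rewrite ltnS leq_eqVlt linearB linearZ /= => /orP[/eqP ->|ltc].
    by rewrite Gj mulr1 subrr.
  by rewrite H0 // Glt // mulr0 subrr.
Qed.

Lemma standard_dim Fs rs c : standard Fs rs ->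
  \dim (<<Fs>> :&: below c) = (\sum_(i < k | i < c) rs i)%N.
Proof.
move=> stF; have [ps ech] := standard_echelon stF; rewrite (dim_below_top c ech).
by case: stF => _ _ rsE; apply: eq_bigr => i _; exact: rsE.
Qed.

(** The case [c = 0] excludes nonzero constants, so an echelon basis exists; the successive
    differences of the dimensions are its numbers of members with each top variable. *)
Lemma standard_exists V (rs : 'I_k -> nat) :
  (forall c, \dim (V :&: below c) = \sum_(i < k | i < c) rs i)%N ->
  exists2 Fs, standard Fs rs & <<Fs>>%VS = V.
Proof.
move=> dimV; have [|Fs [ps [ech FsV]]] := @echelon_exists V.
  by apply/eqP; rewrite -dimv_eq0 dimV big_pred0.
exists Fs => //; have [indep rrefF _] := echelon_standard ech; split=> // i.
have split_sum (r : 'I_k -> nat) :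
    (\sum_(j < k | j < i.+1) r j = r i + \sum_(j < k | j < i) r j)%N.
  rewrite (bigD1 i) //=; congr addn; apply: eq_bigl => j.
  by rewrite ltnS ltn_neqAle andbC.
have := dim_below_top i.+1 ech; rewrite FsV dimV !split_sum.
by rewrite -(dim_below_top i ech) FsV dimV => /addIn ->.
Qed.

End Standard.

(** * Restriction to subsets of the variables *)

Section Families.
Variables (p d k : nat) (M : quadform p d).
Implicit Types (F G : mquad p d k) (J : seq (mquad p d k)).

Lemma mq_zerosP J n :
  reflect (forall F, F \in <<J>>%VS -> mq_eval M F n = 0) (n \in mq_zeros M J).
Proof.
rewrite inE; apply: (iffP allP) => [J0 F /mem_span_nth[a ->]|J0 F FJ].
  rewrite -[LHS]/(mq_at M n _) linear_sum big1 // => i _.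
  by rewrite linearZ /= /mq_at (eqP (J0 _ _)) ?mulr0 ?mem_nth.
by apply/eqP/J0; exact: memv_span.
Qed.

Lemma consistentP J : consistent M J <->
  forall F c, F \in <<J>>%VS -> (forall n, mq_eval M F n = c) -> c = 0.
Proof.
have evalE (a : 'I_(size J) -> 'F_p) n : mq_eval M (\sum_i a i *: J`_i) n =
    \sum_(s < size J) a s * mq_eval M J`_s n.
  rewrite -[LHS]/(mq_at M n _) linear_sum; apply: eq_bigr => i _.
  by rewrite linearZ.
split=> [consJ F c /mem_span_nth[a ->] Fc|consJ a c Fc].
  by apply: (consJ a) => n; rewrite -evalE.
apply: (consJ (\sum_i a i *: J`_i)) => [|n]; last by rewrite evalE.
by apply: memv_suml => i _; apply/memvZ/memv_span/mem_nth.
Qed.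

Lemma mq_depends0P F (j : 'I_k) : ~~ mq_depends F j <->
  [/\ row j (mq_v F) = 0, forall l, mq_bmx F j l = 0 &
      forall l, mq_bmx F l j = 0].
Proof.
split=> [/norP[/negPn/eqP vj /existsPn bj]|[vj bj bj']].
  by split=> // l; rewrite mxE; case: insubP => [x _ xE|] //=;
    have := bj x; rewrite xE eqxx ?orbT andbT negbK => /eqP.
apply/norP; rewrite vj eqxx; split=> //; apply/existsPn => x.
by rewrite -mq_bmxE; apply/negP => /andP[bx /orP[]/eqP xj];
  rewrite xj ?bj ?bj' eqxx in bx.
Qed.

(** Conditions on rows suffice because [mq_bmx F] is lower triangular. *)
Lemma below_mxP F c : F \in below p d k c <->
  (forall i : 'I_k, (c <= i)%N -> row i (mq_v F) = 0) /\
  (forall i j : 'I_k, (c <= i)%N -> mq_bmx F i j = 0).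
Proof.
split=> [/belowP F0|[v0 b0]]; first by split=> i => [|j] /F0/mq_depends0P[].
apply/belowP => i lei; apply/mq_depends0P; split=> [|l|l]; [exact: v0 | exact: b0 |].
have [ltli|leil] := ltnP l i; first exact: mq_bmx_up.
exact/b0/(leq_trans lei).
Qed.

Lemma below_monotone c c' : (c <= c')%N -> (below p d k c <= below p d k c')%VS.
Proof.
move=> lec; apply/subvP => F /belowP F0; apply/belowP => i lei.
exact/F0/(leq_trans lec).
Qed.

Lemma below_cap c c' :
  (below p d k c :&: below p d k c' = below p d k (minn c c'))%VS.
Proof.
apply/eqP; rewrite eqEsubv; apply/andP; split; last first.
  by rewrite subv_cap !below_monotone ?geq_minl ?geq_minr.
apply/subvP => F; rewrite memv_cap => /andP[/belowP F1 /belowP F2].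
by apply/belowP => i; rewrite geq_min => /orP[/F1|/F2].
Qed.

Lemma eval_below0 F n : F \in below p d k 0 -> mq_eval M F n = mq_u F.
Proof.
move=> /below_mxP[v0 b0]; rewrite mq_evalE.
have -> : mq_bmx F = 0 by apply/matrixP => i j; rewrite b0 ?mxE.
have -> : mq_v F = 0 by apply/row_matrixP => i; rewrite v0 ?row0.
by rewrite !mul0mx !linear0 !add0r.
Qed.

End Families.

Section Glue.
Variables (p d k : nat) (I : {set 'I_k}).

Lemma glue_rows (n : 'M['F_p]_(k, d)) :
  glue (\matrix_(a < #|I|) row (enum_val a) n)
       (\matrix_(b < #|~: I|) row (enum_val b) n) = n.
Proof.
apply/row_matrixP => i; have [iI|iI] := boolP (i \in I).
  by rewrite -(enum_rankK_in iI iI) row_glue_in rowK.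
have iO : i \in ~: I by rewrite inE.
by rewrite -(enum_rankK_in iO iO) row_glue_out rowK.
Qed.

Lemma sum_glue (V : nmodType) (f : 'M['F_p]_(k, d) -> V) :
  \sum_n f n = \sum_(x : 'M['F_p]_(#|I|, d)) \sum_(y : 'M['F_p]_(#|~: I|, d))
    f (glue x y).
Proof.
rewrite pair_big /=.
pose g (u : 'M['F_p]_(#|I|, d) * 'M['F_p]_(#|~: I|, d)) := glue u.1 u.2.
pose h (n : 'M['F_p]_(k, d)) : 'M['F_p]_(#|I|, d) * 'M['F_p]_(#|~: I|, d) :=
  (\matrix_a row (enum_val a) n, \matrix_b row (enum_val b) n).
rewrite (reindex g) //; apply/onW_bij/(Bijective (g := h)) => [[x y]|n].
  congr pair; apply/row_matrixP => a; rewrite rowK.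
    by rewrite row_glue_in.
  by rewrite row_glue_out.
exact: glue_rows.
Qed.

End Glue.

Section Restriction.
Variables (p d k : nat) (M : quadform p d) (I : {set 'I_k}).
Implicit Types (F G : mquad p d k) (J : seq (mquad p d k)).

Lemma enum_val_mono (A : {set 'I_k}) (a b : 'I_#|A|) :
  (a < b)%N -> (enum_val a < enum_val b)%N.
Proof.
move=> ltab; have x0 := enum_val a; rewrite !(enum_val_nth x0).
have srt : sorted (fun i j : 'I_k => (i < j)%N) (enum A).
  rewrite /enum_mem; apply: sorted_filter => [i j l|]; first exact: ltn_trans.
  by have := iota_ltn_sorted 0 k; rewrite -val_enum_ord sorted_map -enumT.
apply: (sorted_ltn_nth _ x0 srt) => //; rewrite ?inE -?cardE ?ltn_ord //.
by move=> i j l; exact: ltn_trans.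
Qed.

(** Initial segments of the enumeration of [A] are traces of initial segments of all indices, so the
    filtrations [below] can be compared before and after restriction. If [c] exceeds all positions,
    [k] serves as threshold. *)
Lemma threshold (A : {set 'I_k}) c :
  exists T, forall a : 'I_#|A|, (a < c)%N = (enum_val a < T)%N.
Proof.
have [ltc|gec] := ltnP c #|A|; last first.
  by exists k => a; rewrite ltn_ord (leq_trans (ltn_ord a)).
exists (enum_val (Ordinal ltc)) => a; apply/idP/idP => [lt|].
  exact: (@enum_val_mono A a (Ordinal ltc)).
apply: contraTT; rewrite -!leqNgt leq_eqVlt => /orP[/eqP ca|ltca].
  by rewrite (_ : Ordinal ltc = a) //; exact: val_inj.
exact/ltnW/(@enum_val_mono A (Ordinal ltc) a).
Qed.

Lemma sum_threshold (A : {set 'I_k}) c T (rs : 'I_k -> nat) :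
  (forall a : 'I_#|A|, (a < c)%N = (enum_val a < T)%N) ->
  (\sum_(a < #|A| | a < c) rs (enum_val a) = \sum_(i in A | i < T) rs i)%N.
Proof.
move=> cT; rewrite big_enum_val_cond /=.
by apply: eq_bigl => a; rewrite cT.
Qed.

Definition embed (A : {set 'I_k}) (x : 'M['F_p]_(#|A|, d)) : 'M['F_p]_(k, d) :=
  (rowsub (fun a : 'I_#|A| => enum_val a) 1%:M)^T *m x.

Lemma embedE A x i c :
  @embed A x i c = \sum_(a < #|A| | enum_val a == i) x a c.
Proof.
rewrite mxE [RHS]big_mkcond; apply: eq_bigr => a _; rewrite !mxE.
by case: (_ == _); rewrite ?mul1r ?mul0r.
Qed.

Lemma glueE x y : glue x y = @embed I x + @embed (~: I) y.
Proof.
apply/matrixP => i c; rewrite [RHS]mxE !embedE [LHS]mxE [LHS]mxE !summxE.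
by congr (_ + _); apply: eq_bigr => a _; rewrite mxE.
Qed.

Definition sub_in : mquad p d k -> mquad p d #|I| :=
  mq_sub M (fun a : 'I_#|I| => enum_val a) 0.

Definition sub_out (x : 'M['F_p]_(#|I|, d)) : mquad p d k -> mquad p d #|~: I| :=
  mq_sub M (fun a : 'I_#|~: I| => enum_val a) (embed x).

HB.instance Definition _ := GRing.Linear.on sub_in.
HB.instance Definition _ x := GRing.Linear.on (sub_out x).

Lemma eval_sub_in F x : mq_eval M (sub_in F) x = mq_eval M F (embed x).
Proof. by rewrite mq_eval_sub ?add0r //; exact: enum_val_mono. Qed.

Lemma eval_sub_out F x y : mq_eval M (sub_out x F) y = mq_eval M F (glue x y).
Proof. by rewrite mq_eval_sub ?glueE //; exact: enum_val_mono. Qed.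

Lemma fiber_set_zeros J x :
  fiber_set M J x = mq_zeros M [seq sub_out x F | F <- J].
Proof.
apply/setP => y; rewrite !inE all_map; apply: eq_all => F /=.
by rewrite eval_sub_out.
Qed.

Lemma sub_out_constant F x : (forall j, j \notin I -> ~~ mq_depends F j) ->
  sub_out x F \in below p d #|~: I| 0.
Proof.
move=> F0.
have {}F0 (a : 'I_#|~: I|) : ~~ mq_depends F (enum_val a).
  by apply: F0; have := enum_valP a; rewrite inE.
apply/below_mxP; split=> a => [_|b _].
  have /mq_depends0P[va ba ba'] := F0 a.
  apply/rowP => c; rewrite !mxE.
  have := congr1 (fun u : 'rV_d => u 0 c) va; rewrite !mxE => ->.
  rewrite add0r big1 // => l _; rewrite mxE big1 ?mul0r // => m _.
  by rewrite mq_symE ba ba' addr0 mul0r.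
rewrite mq_bmx_sub; last exact: enum_val_mono.
by rewrite [LHS]mxE; have /mq_depends0P[_ ba _] := F0 a; exact: ba.
Qed.

Lemma eval_glue_indep F x y : (forall j, j \notin I -> ~~ mq_depends F j) ->
  mq_eval M F (glue x y) = mq_eval M (sub_in F) x.
Proof.
move=> F0; rewrite -eval_sub_out (eval_below0 M _ (sub_out_constant x F0)).
by rewrite eval_sub_in.
Qed.

Lemma proj_set_zeros J :
  (forall F, F \in J -> forall j, j \notin I -> ~~ mq_depends F j) ->
  proj_set M I J = mq_zeros M [seq sub_in F | F <- J].
Proof.
move=> J0; apply/setP => x; rewrite !inE all_map.
apply/forallP/allP => [all0 F FJ|all0 y].
  have := all0 0; rewrite inE => /allP/(_ F FJ) /=.
  by rewrite (eval_glue_indep _ _ (J0 F FJ)).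
rewrite inE; apply/allP => F FJ; rewrite (eval_glue_indep _ _ (J0 F FJ)).
exact: (all0 F FJ).
Qed.

End Restriction.

(** * Exceptional points *)

(** A point satisfying [P a] is counted for all p - 1 nonzero multiples of [a], which gains the
    factor [p.-1] over a plain union bound. *)
Lemma double_count (p r : nat) (T : finType) (P : 'rV['F_p]_r -> pred T)
    (w m : nat) : prime p ->
  (forall a c x, c != 0 -> P a x -> P (c *: a) x) ->
  (forall a, a != 0 -> (#|[set x | P a x]| * w <= m)%N) ->
  (#|[set x | [exists a, (a != 0%R) && P a x]]| * w * p.-1 <= (p ^ r).-1 * m)%N.
Proof.
move=> p_pr P_scale P_card; set E := [set x | _].
pose V := [set~ (0 : 'rV['F_p]_r)].
have cardV : #|V| = (p ^ r).-1 by rewrite cardsC1 card_mx card_Fp // mul1n.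
have ge : (#|E| * p.-1 <= \sum_(a in V) #|[set x | P a x]|)%N.
  rewrite -sum_nat_const.
  under [leqRHS]eq_bigr do rewrite -sum1_card big_set.
  rewrite (exchange_big_dep predT) //= [leqRHS](bigID (mem E)) /=.
  apply: leq_trans (leq_addr _ _); apply: leq_sum => x.
  rewrite inE => /existsP[a0 /andP[a00 Pa0]].
  rewrite sum1_card -{1}(card_Fp p_pr) -(cardC1 (0 : 'F_p)).
  have inj : injective (fun c : 'F_p => c *: a0).
    move=> c c' /eqP; rewrite -subr_eq0 -scalerBl scaler_eq0 (negPf a00) orbF.
    by rewrite subr_eq0 => /eqP.
  rewrite -(card_image inj); apply/subset_leq_card/subsetP => _ /imageP[c c0 ->].
  rewrite !inE in c0; rewrite unfold_in /= !inE scaler_eq0 negb_or c0 a00 /=.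
  exact: P_scale.
rewrite mulnAC; apply: leq_trans (leq_mul ge (leqnn w)) _.
rewrite big_distrl /= -cardV -sum_nat_const leq_sum // => a.
by rewrite !inE => /P_card.
Qed.

Section BadPoints.
Variables (p d k : nat) (M : quadform p d) (I : {set 'I_k}).
Hypothesis p_pr : prime p.
Implicit Types (F G : mquad p d k) (x : 'M['F_p]_(#|I|, d)).
Local Notation A := (qf_mx M).
Local Notation rho := (qf_rank M).

(** Freezing [x] turns the products with variables in [I] into a linear term, a row of
    [mq_sym F *m embed x *m A]; the products with variables outside [I] survive. *)
Lemma sub_out_dependsP F x (a : 'I_#|~: I|) :
  ~~ mq_depends (sub_out M x F) a <->
  row (enum_val a) (mq_v F + mq_sym F *m embed x *m A) = 0 /\
  forall l, l \notin I -> mq_bmx F (enum_val a) l = 0 /\ mq_bmx F l (enum_val a) = 0.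
Proof.
have bE a' b' : mq_bmx (sub_out M x F) a' b' = mq_bmx F (enum_val a') (enum_val b').
  by rewrite mq_bmx_sub; [rewrite [LHS]mxE | exact: enum_val_mono].
have vE : row a (mq_v (sub_out M x F)) =
    row (enum_val a) (mq_v F + mq_sym F *m embed x *m A).
  by apply/rowP => c; rewrite [LHS]mxE [LHS]mxE [RHS]mxE.
rewrite -vE; split=> [/mq_depends0P[-> ba ba']|[va ba]].
  split=> // l lI; have lO : l \in ~: I by rewrite inE.
  by rewrite -(enum_rankK_in lO lO) -!bE ba ba'.
have nI (b : 'I_#|~: I|) : enum_val b \notin I by have := enum_valP b; rewrite inE.
by apply/mq_depends0P; split=> // b; rewrite bE; have [] := ba _ (nI b).
Qed.

(** If [C] couples the variable to one in [I], losing it imposes an equation [u x A = - v] with [u]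
    nonzero, satisfied by at most a fraction p^(-rho) of the points. Otherwise its terms are
    unaffected by [x], and the set is empty. *)
Lemma card_fiber_indep F (a : 'I_#|~: I|) : mq_depends F (enum_val a) ->
  (#|[set x | ~~ mq_depends (sub_out M x F) a]| * p ^ rho <= p ^ (#|I| * d))%N.
Proof.
have jI : enum_val a \notin I by have := enum_valP a; rewrite inE.
move=> Fj; pose C := mq_sym F.
have [/existsP[l /andP[lI Cjl]]|/existsPn C0] :=
    boolP [exists l, (l \in I) && (C (enum_val a) l != 0)]; last first.
  rewrite (_ : [set x | _] = set0) ?cards0 ?mul0n //.
  apply/setP => x; rewrite !inE; apply/negbTE/negP => /sub_out_dependsP[v0 b0].
  have Bj l : mq_bmx F (enum_val a) l = 0 /\ mq_bmx F l (enum_val a) = 0.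
    have [lI|lnI] := boolP (l \in I); last exact: b0.
    have := C0 l; rewrite lI negbK /C mq_symE => /eqP.
    case: (ltngtP l (enum_val a)) => [ltlj|ltjl|/val_inj lj].
    - by rewrite (mq_bmx_up F ltlj) addr0.
    - by rewrite (mq_bmx_up F ltjl) add0r.
    - by rewrite -lj lI in jI.
  suff : ~~ mq_depends F (enum_val a) by rewrite Fj.
  apply/mq_depends0P; split=> [|l|l]; try by have [] := Bj l.
  move: v0; rewrite linearD /= row_mul (_ : row _ (_ *m _) = 0) ?mul0mx ?addr0 //.
  apply/rowP => c; rewrite !mxE big1 // => l _.
  by rewrite mq_symE; have [-> ->] := Bj l; rewrite addr0 mul0r.
pose T := (rowsub (fun b : 'I_#|I| => enum_val b) 1%:M)^T : 'M['F_p]_(k, #|I|).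
pose u := row (enum_val a) C *m T.
have u_free : row_free u.
  rewrite /row_free rank_rV; suff -> : u != 0 by [].
  have TE m : T m (enum_rank_in lI l) = (l == m)%:R.
    by rewrite !mxE enum_rankK_in.
  apply: contraNneq Cjl => /(congr1 (fun w : 'rV_#|I| => w 0 (enum_rank_in lI l))).
  rewrite mxE [RHS]mxE (bigD1 l) //= big1 => [|m ml].
    by rewrite addr0 TE [row _ _ _ _]mxE eqxx mulr1 => ->.
  by rewrite TE eq_sym (negPf ml) mulr0.
have := @card_mulmx_fiber _ _ _ _ _ u A (- row (enum_val a) (mq_v F)) u_free.
rewrite card_Fp // mul1n; apply: leq_trans.
rewrite leq_mul2r subset_leq_card ?orbT //; apply/subsetP => x.
rewrite !inE => /sub_out_dependsP[v0 _]; rewrite -subr_eq0 opprK addrC -v0 linearD /=.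
by rewrite /u !row_mul -!mulmxA.
Qed.

Local Notation bcomb C := (mq_comb (fun s : 'I_(\dim C) => (vbasis C)`_s)).

Lemma bcombP (C : {vspace mquad p d k}) F : F \in C -> F != 0 ->
  exists2 a, a != 0 & F = bcomb C a.
Proof.
move=> FC F0; pose a := \row_s coord (vbasis C) s F.
have FE : F = bcomb C a.
  by rewrite {1}(coord_vbasis FC); apply: eq_bigr => s _; rewrite mxE.
by exists a => //; apply: contraNneq F0 => a0; rewrite FE a0 linear0.
Qed.

Lemma bcomb_in (C : {vspace mquad p d k}) a : bcomb C a \in C.
Proof.
by apply: memv_suml => s _; apply/memvZ/vbasis_mem/mem_nth; rewrite size_tuple.
Qed.

Lemma bcomb_neq0 (C : {vspace mquad p d k}) a : a != 0 -> bcomb C a != 0.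
Proof.
apply: contraNneq => C0; apply/eqP/rowP => s.
have /freeP/(_ (fun s => a 0 s) C0 s) -> := basis_free (vbasisP C).
by rewrite mxE.
Qed.

Lemma card_fiber_indep_space (C : {vspace mquad p d k}) (a : 'I_#|~: I|) :
  (forall F, F \in C -> F != 0 -> mq_depends F (enum_val a)) ->
  exists E : {set 'M['F_p]_(#|I|, d)},
    (#|E| * p ^ rho * p.-1 <= (p ^ \dim C).-1 * p ^ (#|I| * d))%N /\
    forall x, x \notin E -> forall F, F \in C -> F != 0 ->
      mq_depends (sub_out M x F) a.
Proof.
move=> Ca.
exists [set x | [exists c, (c != 0) && ~~ mq_depends (sub_out M x (bcomb C c)) a]].
split=> [|x].
  apply: (@double_count p (\dim C) _
    (fun c x => ~~ mq_depends (sub_out M x (bcomb C c)) a) (p ^ rho)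
    (p ^ (#|I| * d)) p_pr) => [b c x _|b b0].
    rewrite !linearZ /= => /mq_depends0P[va ba ba'].
    apply/mq_depends0P; split=> [|l|l]; rewrite !linearZ /= ?va ?scaler0 //.
      by rewrite mxE ba mulr0.
    by rewrite mxE ba' mulr0.
  by apply: card_fiber_indep => //; apply: Ca; [exact: bcomb_in | exact: bcomb_neq0].
rewrite inE => /existsPn nodeg F FC F0.
have [b b0 ->] := bcombP FC F0.
by have := nodeg b; rewrite b0 negbK.
Qed.

(** For an arbitrary [I] it is only asked that no nonzero function of [U] become constant on the
    fibre; this is enough to estimate the size of the fibre. *)
Lemma exceptional_set (U : {vspace mquad p d k}) :
  (forall F, F \in U -> F != 0 -> exists2 j, j \notin I & mq_depends F j) ->
  exists E : {set 'M['F_p]_(#|I|, d)},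
    (#|E| * p ^ rho <= p ^ \dim U * p ^ (#|I| * d))%N /\
    forall x, x \notin E -> forall F, F \in U ->
      sub_out M x F \in below p d #|~: I| 0 -> F = 0.
Proof.
move=> Udep.
pose P a x := sub_out M x (bcomb U a) \in below p d #|~: I| 0.
exists [set x | [exists a, (a != 0) && P a x]]; split=> [|x].
  suff E_le : (#|[set x | [exists a, (a != 0%R) && P a x]]| * p ^ rho * p.-1 <=
      (p ^ \dim U).-1 * p ^ (#|I| * d))%N.
    apply: leq_trans (_ : _ <= _ * p.-1)%N _.
      by apply: leq_pmulr; rewrite -subn1 subn_gt0 prime_gt1.
    by apply: leq_trans E_le _; rewrite leq_mul2r leq_pred orbT.
  apply: (@double_count p (\dim U) _ P (p ^ rho) (p ^ (#|I| * d)) p_pr) =>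
    [a c x _|a a0]; first by rewrite /P !linearZ /= => aP; exact: memvZ.
  have [j jI Fj] := Udep _ (bcomb_in a) (bcomb_neq0 a0).
  have jO : j \in ~: I by rewrite inE.
  rewrite -(enum_rankK_in jO jO) in Fj.
  apply: leq_trans (card_fiber_indep Fj); rewrite leq_mul2r.
  rewrite subset_leq_card ?orbT //; apply/subsetP => x; rewrite !inE /P.
  by move=> /belowP; exact.
rewrite inE => /existsPn noP F FU FO; apply/eqP/negPn/negP => F0.
have [a a0 FE] := bcombP FU F0.
by have := noP a; rewrite a0 /P -FE FO.
Qed.

End BadPoints.

(** * Projections and fibres *)

Lemma memv0_eq (K : fieldType) (vT : vectType K) (v : vT) :
  v \in 0%VS -> v = 0.
Proof. by rewrite memv0 => /eqP. Qed.

Lemma span_map_linear (K : fieldType) (U V : vectType K) (f : {linear U -> V})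
    (J : seq U) : (<<map f J>> = linfun f @: <<J>>)%VS.
Proof.
by rewrite limg_span; congr <<_>>%VS; apply: eq_map => F; rewrite lfunE.
Qed.

Section Decomposition.
Variables (p d k : nat) (M : quadform p d) (I : {set 'I_k}).
Variables (J J' J'' : seq (mquad p d k)).
Hypothesis dec : I_decomposition I J J' J''.
Implicit Types F : mquad p d k.

(** The component of [F] in [<<J''>>] is a difference of two functions of the variables in [I],
    hence 0. *)
Lemma decomposition_in F :
  F \in <<J>>%VS -> (forall j, j \notin I -> ~~ mq_depends F j) -> F \in <<J'>>%VS.
Proof.
have [JE _ indep dep] := dec; rewrite JE => /memv_addP[F1 F1J [F2 F2J ->]] F0.
have [-> |/(dep _ F2J)[j jI]] := eqVneq F2 0; first by rewrite addr0.
have /mq_depends0P[v1 b1 b1'] := indep _ F1J j jI.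
have /mq_depends0P[v0 b0 b0'] := F0 j jI.
move=> F2j; suff : ~~ mq_depends F2 j by rewrite F2j.
apply/mq_depends0P.
have FE : F2 = (F1 + F2) - F1 by rewrite addrC addKr.
split=> [|l|l]; rewrite FE !linearB /=.
- by rewrite v0 v1 subrr.
- by rewrite [LHS]mxE b0 [X in _ + X]mxE b1 subrr.
- by rewrite [LHS]mxE b0' [X in _ + X]mxE b1' subrr.
Qed.

Lemma decomposition_dim : (\dim <<J'>> + \dim <<J''>> = \dim <<J>>)%N.
Proof. by have [-> cap0 _ _] := dec; rewrite dimv_disjoint_sum. Qed.

Lemma decomposition_subl : (<<J'>> <= <<J>>)%VS.
Proof. by have [-> _ _ _] := dec; exact: addvSl. Qed.

Lemma decomposition_subr : (<<J''>> <= <<J>>)%VS.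
Proof. by have [-> _ _ _] := dec; exact: addvSr. Qed.

Lemma decomposition_zeros x y :
  (glue x y \in mq_zeros M J) =
  (x \in proj_set M I J') && (y \in fiber_set M J'' x).
Proof.
have [JE _ indep dep] := dec.
have indep' F : F \in J' -> forall j, j \notin I -> ~~ mq_depends F j.
  by move=> FJ; apply: indep; exact: memv_span.
have projE : (x \in proj_set M I J') = (glue x y \in mq_zeros M J').
  rewrite proj_set_zeros // !inE all_map; apply: eq_in_all => F FJ /=.
  by rewrite (eval_glue_indep _ _ _ (indep' _ FJ)).
have fiberE : (y \in fiber_set M J'' x) = (glue x y \in mq_zeros M J'').
  by rewrite inE.
rewrite projE fiberE.
apply/mq_zerosP/andP => [J0|[/mq_zerosP J0 /mq_zerosP J0'] F].
  split; apply/mq_zerosP => F FJ; apply: J0; rewrite JE.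
    exact: subvP (addvSl _ _) _ FJ.
  exact: subvP (addvSr _ _) _ FJ.
rewrite JE => /memv_addP[F1 F1J [F2 F2J ->]].
by rewrite -[LHS]/(mq_at M _ _) linearD /= /mq_at J0 // J0' // addr0.
Qed.

Lemma consistent_proj : consistent M J -> consistent_Mset M (proj_set M I J').
Proof.
have [JE _ indep _] := dec; move=> /consistentP consJ.
exists [seq sub_in M I F | F <- J']; last first.
  by apply: proj_set_zeros => F FJ; apply: indep; exact: memv_span.
apply/consistentP => G c; rewrite span_map_linear => /memv_imgP[F FJ ->] Fc.
apply: (consJ F) => [|n]; first exact: subvP decomposition_subl _ FJ.
rewrite -(glue_rows I n) (eval_glue_indep _ _ _ (indep _ FJ)).
by have := Fc (\matrix_(a < #|I|) row (enum_val a) n); rewrite lfunE.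
Qed.

End Decomposition.

Lemma has_standard_of_dim (p d k : nat) (M : quadform p d)
    (J : seq (mquad p d k)) rs :
  (forall c, \dim (<<J>> :&: below p d k c) = \sum_(i < k | i < c) rs i)%N ->
  has_standard_rep M (mq_zeros M J) rs.
Proof.
move=> /standard_exists[Fs stF FsJ]; exists Fs => //.
by apply/setP => n; apply/mq_zerosP/mq_zerosP; rewrite FsJ.
Qed.

(** Compatibility with the filtrations yields injectivity: a kernel element is sent into [below 0],
    so it lies in [below 0] already and vanishes. *)
Lemma dim_limg_below (p d k : nat) (A : {set 'I_k})
    (f : {linear mquad p d k -> mquad p d #|A|}) (J : seq (mquad p d k)) c T :
  (forall c T, (forall a : 'I_#|A|, (a < c)%N = (enum_val a < T)%N) ->
     forall F, F \in <<J>>%VS ->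
       (f F \in below p d #|A| c) = (F \in below p d k T)) ->
  (<<J>> :&: below p d k 0 = 0)%VS ->
  (forall a : 'I_#|A|, (a < c)%N = (enum_val a < T)%N) ->
  \dim (<<map f J>> :&: below p d #|A| c) = \dim (<<J>> :&: below p d k T).
Proof.
move=> fbelow J0 cT.
have -> : (<<map f J>> :&: below p d #|A| c =
           linfun f @: (<<J>> :&: below p d k T))%VS.
  rewrite span_map_linear; apply/eqP; rewrite eqEsubv; apply/andP; split.
    apply/subvP => G; rewrite memv_cap => /andP[/memv_imgP[F FJ ->]].
    rewrite lfunE /= (fbelow _ _ cT) // => FT.
    by rewrite -[f F]lfunE memv_img // memv_cap FJ.
  apply/subvP => G /memv_imgP[F]; rewrite memv_cap => /andP[FJ FT] ->.
  by rewrite memv_cap memv_img //= lfunE /= (fbelow _ _ cT).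
apply: limg_dim_eq; apply/eqP; rewrite -subv0; apply/subvP => F.
rewrite memv_cap memv_ker memv_cap lfunE /= => /andP[/andP[FJ _] /eqP fF].
by rewrite -J0 memv_cap FJ -(fbelow 0%N 0%N) ?fF ?mem0v.
Qed.

(** A geometric series with [r] terms, each at most [p ^ r.-1]. The factor [p.-1] will cancel that
    of [double_count], which leaves the bound stated in (ii). *)
Lemma predn_exp_le (p r : nat) : (0 < p)%N ->
  ((p ^ r).-1 <= p.-1 * (r * p ^ r.-1))%N.
Proof.
move=> p0; rewrite predn_exp leq_mul2l; apply/orP; right.
have : (r * p ^ r.-1 = \sum_(i < r) p ^ r.-1)%N by rewrite sum_nat_const card_ord.
move=> ->; apply: leq_sum => i _; rewrite leq_pexp2l //.
by case: r i => [[]|r] //= i; rewrite -ltnS.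
Qed.

Section InitialSegment.
Variables (p d k : nat) (M : quadform p d) (k' : nat).
Hypothesis p_pr : prime p.
Local Notation I := [set i : 'I_k | (i < k')%N].
Variables (J J' J'' : seq (mquad p d k)) (rs : 'I_k -> nat).
Hypothesis dec : I_decomposition I J J' J''.
Hypothesis dimJ : forall c,
  \dim (<<J>> :&: below p d k c) = (\sum_(i < k | i < c) rs i)%N.
Implicit Types F : mquad p d k.
Local Notation rho := (qf_rank M).

Lemma span_in_below : <<J'>>%VS = (<<J>> :&: below p d k k')%VS.
Proof.
have [JE _ indep _] := dec; apply/eqP; rewrite eqEsubv; apply/andP; split.
  apply/subvP => F FJ; rewrite memv_cap (subvP (decomposition_subl dec)) //=.
  by apply/belowP => i lei; apply: indep => //; rewrite inE -leqNgt.
apply/subvP => F; rewrite memv_cap => /andP[FJ /belowP Fk'].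
apply: (decomposition_in dec) => // j; rewrite inE -leqNgt; exact: Fk'.
Qed.

Lemma span_below0 : (<<J>> :&: below p d k 0 = 0)%VS.
Proof. by apply/eqP; rewrite -dimv_eq0 dimJ big_pred0. Qed.

Lemma sub_below0 (U : {vspace mquad p d k}) : (U <= <<J>>)%VS ->
  (U :&: below p d k 0 = 0)%VS.
Proof.
move=> UJ; apply/eqP; rewrite -subv0 -span_below0.
by rewrite subv_cap capvSr (subv_trans (capvSl _ _) UJ).
Qed.

Lemma dim_in_below T :
  \dim (<<J'>> :&: below p d k T) = (\sum_(i in I | i < T) rs i)%N.
Proof.
rewrite span_in_below -capvA below_cap dimJ; apply: eq_bigl => i.
by rewrite inE leq_min.
Qed.

Lemma cap_out_below T : (T <= k')%N -> (<<J''>> :&: below p d k T = 0)%VS.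
Proof.
have [_ cap0 _ _] := dec => leT; apply/eqP; rewrite -subv0 -cap0 span_in_below.
rewrite !subv_cap capvSl andbT (subv_trans (capvSl _ _)) ?(decomposition_subr dec) //=.
by rewrite (subv_trans (capvSr _ _)) ?below_monotone.
Qed.

(** For [T] beyond [k'] the modular law splits the part of [<<J>>] in [below T] into [<<J'>>] and
    the part of [<<J''>>] in [below T]; for smaller [T] the latter is 0. *)
Lemma dim_out_below T :
  \dim (<<J''>> :&: below p d k T) = (\sum_(i in ~: I | i < T) rs i)%N.
Proof.
have [leT|ltT] := leqP T k'.
  rewrite cap_out_below // dimv0 big_pred0 // => i.
  rewrite !inE -leqNgt; apply/negP => /andP[lei /(leq_ltn_trans lei)].
  by rewrite ltnNge leT.
have [JE cap0 _ _] := dec.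
have : (<<J>> :&: below p d k T = <<J'>> + (<<J''>> :&: below p d k T))%VS.
  rewrite JE capvC capvC -vspace_modl //.
  rewrite span_in_below (subv_trans (capvSr _ _)) ?below_monotone //; exact: ltnW.
move=> /(congr1 (fun U => \dim U)) /=; rewrite dimv_disjoint_sum; last first.
  by apply/eqP; rewrite -subv0 -cap0 capvS ?capvSl.
rewrite (dimJ T) span_in_below (dimJ k') (bigID (fun i : 'I_k => (i < k')%N)) /=.
rewrite (eq_bigl (fun i : 'I_k => (i < k')%N)) => [|i]; last first.
  by apply/andP/idP => [[]//|lti]; split=> //; exact: ltn_trans lti ltT.
move=> /addnI <-; apply: eq_bigl => i; by rewrite !inE andbC.
Qed.

Lemma sub_in_below c T F :
  (forall a : 'I_#|I|, (a < c)%N = (enum_val a < T)%N) -> F \in <<J'>>%VS ->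
  (sub_in M I F \in below p d #|I| c) = (F \in below p d k T).
Proof.
move=> cT; rewrite span_in_below memv_cap => /andP[_ /below_mxP[vk' bk']].
have bE a b : mq_bmx (sub_in M I F) a b = mq_bmx F (enum_val a) (enum_val b).
  by rewrite mq_bmx_sub; [rewrite [LHS]mxE | exact: enum_val_mono].
have vE a : row a (mq_v (sub_in M I F)) = row (enum_val a) (mq_v F).
  by apply/rowP => l; rewrite [LHS]mxE [LHS]mxE [RHS]mxE mulmx0 mul0mx addr0.
apply/idP/idP => /below_mxP[v0 b0]; apply/below_mxP.
  have inI (i : 'I_k) : (T <= i)%N -> (i < k')%N -> exists2 a : 'I_#|I|,
      (c <= a)%N & enum_val a = i.
    move=> lei lti; have iI : i \in I by rewrite inE.
    exists (enum_rank_in iI i); last exact: enum_rankK_in.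
    by rewrite leqNgt cT enum_rankK_in // -leqNgt.
  split=> [i lei|i j lei].
    have [lti|gei] := ltnP i k'; last exact: vk'.
    by have [a ca <-] := inI i lei lti; rewrite -vE v0.
  have [lti|gei] := ltnP i k'; last exact: bk'.
  have [ltij|leji] := ltnP i j; first exact: mq_bmx_up.
  have [a ca <-] := inI i lei lti.
  have jI : j \in I by rewrite inE (leq_ltn_trans leji).
  by rewrite -(enum_rankK_in jI jI) -bE b0.
split=> [a lea|a b lea]; first by rewrite vE v0 // leqNgt -cT -leqNgt.
by rewrite bE b0 // leqNgt -cT -leqNgt.
Qed.

Lemma has_standard_proj :
  has_standard_rep M (proj_set M I J') (fun a => rs (enum_val a)).
Proof.
have [_ _ indep _] := dec; rewrite proj_set_zeros; last first.
  by move=> F FJ; apply: indep; exact: memv_span.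
apply: has_standard_of_dim => c; have [T cT] := threshold I c.
rewrite (sum_threshold _ cT) -dim_in_below; apply: dim_limg_below cT.
  by move=> c' T' cT' F; exact: sub_in_below.
exact: sub_below0 (decomposition_subl dec).
Qed.

Lemma sub_out_below c T F x :
  (forall a : 'I_#|~: I|, (a < c)%N = (enum_val a < T)%N) ->
  F \in below p d k T -> sub_out M x F \in below p d #|~: I| c.
Proof.
move=> cT /belowP FT; apply/belowP => a lea.
have /mq_depends0P[va ba ba'] : ~~ mq_depends F (enum_val a).
  by apply: FT; rewrite leqNgt -cT -leqNgt.
apply/sub_out_dependsP; split=> [|l _]; last by rewrite ba ba'.
rewrite linearD /= va add0r row_mul (_ : row _ (_ *m _) = 0) ?mul0mx //.
by apply/rowP => j; rewrite !mxE big1 // => l _; rewrite mq_symE ba ba' addr0 mul0r.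
Qed.

(** A complement of one stage of the filtration in the next: its nonzero elements all have top
    variable [enum_val a]. Controlling these is enough to control [<<J''>>]. *)
Local Notation step a :=
  ((<<J''>> :&: below p d k (enum_val a).+1) :\: below p d k (enum_val a))%VS.

Lemma dim_step (a : 'I_#|~: I|) : \dim (step a) = rs (enum_val a).
Proof.
have := dimv_cap_compl (<<J''>> :&: below p d k (enum_val a).+1)
  (below p d k (enum_val a)).
rewrite -capvA (below_cap _ _ _ (enum_val a).+1 (enum_val a)).
rewrite (minn_idPr (leqnSn _)) (dim_out_below (enum_val a)).
rewrite (dim_out_below (enum_val a).+1).
have -> : (\sum_(i in ~: I | i < (enum_val a).+1) rs i =
           \sum_(i in ~: I | i < enum_val a) rs i + rs (enum_val a))%N.
  rewrite (bigD1 (enum_val a)) /=; last by rewrite enum_valP ltnSn.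
  rewrite addnC; congr (_ + _)%N; apply: eq_bigl => i.
  by rewrite ltnS [(i < _)%N]ltn_neqAle -andbA; congr andb; rewrite andbC.
by move/addnI.
Qed.

Lemma mem_step (a : 'I_#|~: I|) F : F \in step a -> F != 0 ->
  [/\ F \in <<J''>>%VS, F \in below p d k (enum_val a).+1 &
      mq_depends F (enum_val a)].
Proof.
move=> FC F0; have := subvP (diffvSl _ _) _ FC; rewrite memv_cap => /andP[FU Flt].
split=> //; suff : mq_top F (enum_val a) by case/andP.
rewrite mq_topE Flt /=; apply/negP => Fa; case/eqP: F0; apply: memv0_eq.
by rewrite -(capv_diff (<<J''>> :&: below p d k (enum_val a).+1)
                       (below p d k (enum_val a)))
  memv_cap FC.
Qed.

(** Let [m] be minimal with [F] in [below m], and suppose [m > T]. The component of [F] in the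
    corresponding step is nonzero, yet its restriction is a difference of two functions free of its
    top variable, against the hypothesis. *)
Lemma sub_out_below_eq x :
  (forall (a : 'I_#|~: I|) F, F \in step a -> F != 0 ->
     mq_depends (sub_out M x F) a) ->
  forall c T, (forall a : 'I_#|~: I|, (a < c)%N = (enum_val a < T)%N) ->
  forall F, F \in <<J''>>%VS ->
    (sub_out M x F \in below p d #|~: I| c) = (F \in below p d k T).
Proof.
move=> good c T cT F FU; apply/idP/idP => [Fc|]; last exact: sub_out_below.
have Fk : exists m, F \in below p d k m.
  by exists k; apply/belowP => i; rewrite leqNgt ltn_ord.
have [m Fm mmin] := ex_minnP Fk.
have [lemT|ltTm] := leqP m T; first exact: subvP (below_monotone _ _ _ lemT) _ Fm.
have lemk : (m <= k)%N.
  by apply: mmin; apply/belowP => i; rewrite leqNgt ltn_ord.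
(* An element of [<<J''>>] that involves only the first [k'] variables is 0. *)
have [lemk'|ltk'm] := leqP m k'.
  suff -> : F = 0 by exact: mem0v.
  by apply: memv0_eq; rewrite -(cap_out_below lemk') memv_cap FU.
case: m => [//|i] in Fm mmin ltTm lemk ltk'm *.
have iO : Ordinal lemk \in ~: I by rewrite !inE -leqNgt.
pose a := enum_rank_in iO (Ordinal lemk).
have aE : enum_val a = Ordinal lemk by exact: enum_rankK_in.
have : F \in (<<J''>> :&: below p d k (enum_val a).+1)%VS.
  by rewrite memv_cap FU aE.
rewrite -(addv_diff_cap (<<J''>> :&: below p d k (enum_val a).+1)
  (below p d k (enum_val a))).
case/memv_addP => F1 F1C [F2 F2a FE].
have F1_0 : F1 != 0.
  apply/eqP => F1_0; have /mmin : F \in below p d k i.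
    rewrite FE F1_0 add0r; move: F2a; rewrite memv_cap => /andP[_].
    by rewrite aE.
  by rewrite ltnn.
have : mq_depends (sub_out M x F1) a by exact: good.
apply: contraTT => _.
have aa (b : 'I_#|~: I|) : (b < a)%N = (enum_val b < enum_val a)%N.
  have [ltba|leab] := ltnP b a; first by rewrite (enum_val_mono ltba).
  move: leab; rewrite leq_eqVlt => /orP[/eqP/val_inj ->|]; first by rewrite ltnn.
  by move=> /enum_val_mono ltab; apply/esym/negbTE; rewrite -leqNgt ltnW.
have F2b : sub_out M x F2 \in below p d #|~: I| a.
  by apply: (sub_out_below x aa); move: F2a; rewrite memv_cap => /andP[].
have F1b : sub_out M x F1 \in below p d #|~: I| (maxn c a).
  have -> : F1 = F - F2 by rewrite FE addrK.
  rewrite linearB; apply: memvB.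
    by apply: subvP (below_monotone _ _ _ (leq_maxl c a)) _ Fc.
  by apply: subvP (below_monotone _ _ _ (leq_maxr c a)) _ F2b.
move/belowP: F1b; apply; rewrite geq_max leqnn andbT leqNgt cT aE -leqNgt.
by rewrite -ltnS.
Qed.

(** The union of one exceptional set for each variable outside [I]; the dimension of each step is at
    most [r']. *)
Lemma exceptional_initial :
  let r' := (\max_(i < k | (k' <= i)%N) rs i)%N in
  exists E : {set 'M['F_p]_(#|I|, d)},
    (#|E| * p ^ rho <= #|~: I| * (r' * p ^ r'.-1 * p ^ (#|I| * d)))%N /\
    forall x, x \notin E ->
      has_standard_rep M (fiber_set M J'' x) (fun b => rs (enum_val b)).
Proof.
move=> r'.
have steps (a : 'I_#|~: I|) : exists E : {set 'M['F_p]_(#|I|, d)},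
    (#|E| * p ^ rho <= r' * p ^ r'.-1 * p ^ (#|I| * d))%N /\
    forall x, x \notin E -> forall F, F \in step a -> F != 0 ->
      mq_depends (sub_out M x F) a.
  have [|E [cardE goodE]] := @card_fiber_indep_space _ _ _ M I p_pr (step a) a.
    by move=> F FC F0; have [] := mem_step FC F0.
  exists E; split=> //; rewrite dim_step in cardE.
  have p1 : (0 < p.-1)%N by rewrite -subn1 subn_gt0 prime_gt1.
  rewrite -(leq_pmul2r p1); apply: leq_trans cardE _.
  rewrite [leqRHS]mulnC mulnA leq_mul2r; apply/orP; right.
  apply: leq_trans (predn_exp_le _ (prime_gt0 p_pr)) _.
  rewrite leq_mul2l; apply/orP; right.
  have le_r : (rs (enum_val a) <= r')%N.
    have lea : (k' <= enum_val a)%N.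
      by have := enum_valP a; rewrite in_setC inE -leqNgt.
    exact: (leq_bigmax_cond _ lea).
  by rewrite leq_mul // leq_pexp2l ?prime_gt0 // -!subn1 leq_sub2r.
have [E EP] := fin_all_exists steps.
exists (\bigcup_a E a); split=> [|x].
  apply: leq_trans (_ : (\sum_a #|E a|) * p ^ rho <= _)%N.
    rewrite leq_mul2r; apply/orP; right.
    elim/big_rec2: _ => [|a m S _ leS]; first by rewrite cards0.
    by rewrite cardsU (leq_trans (leq_subr _ _)) // leq_add2l.
  rewrite big_distrl /= -[X in (_ <= X * _)%N]card_ord -sum_nat_const.
  by apply: leq_sum => a _; have [] := EP a.
move=> xE; rewrite fiber_set_zeros; apply: has_standard_of_dim => c.
have [T cT] := threshold (~: I) c.
rewrite (sum_threshold _ cT) -dim_out_below; apply: dim_limg_below cT; last first.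
  exact: sub_below0 (decomposition_subr dec).
apply: sub_out_below_eq => a F FC F0.
have [_ goodE] := EP a; apply: goodE FC F0.
by apply: contra xE => xEa; apply/bigcupP; exists a.
Qed.

End InitialSegment.

(** * Size estimates *)

Lemma below0_nonconst (p d k : nat) (F : mquad p d k) :
  mq_nonconst F = (F \notin below p d k 0).
Proof.
apply/idP/idP => [|F0].
  apply: contraL => /below_mxP[v0 b0]; rewrite negb_or !negbK.
  apply/andP; split; apply/eqP.
    by apply/matrixP => i j; rewrite [RHS]mxE b0.
  by apply/row_matrixP => i; rewrite row0 v0.
apply: contraR F0; rewrite negb_or !negbK => /andP[/eqP b0 /eqP v0].
by apply/below_mxP; rewrite b0 v0; split=> [i|i j] _; rewrite ?row0 ?mxE.
Qed.

Section Sizes.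
Variables (R : rcfType) (p d k : nat) (M : quadform p d) (J : seq (mquad p d k)).
Hypotheses (p_pr : prime p) (p_odd : p != 2%N).
Hypothesis J0 : (<<J>> :&: below p d k 0 = 0)%VS.
Hypothesis rank_ge : (2 * \dim <<J>> + 1 <= qf_rank M)%N.
Local Notation t := (\dim <<J>>).
Local Notation X := (fun i : 'I_t => (vbasis <<J>>)`_i).
Local Notation s := (Num.sqrt p%:R : R).

Let X_indep a : a != 0 -> mq_nonconst (mq_comb X a).
Proof.
move=> a0; rewrite below0_nonconst; apply/negP => Xa0.
case/eqP: (bcomb_neq0 a0); apply: memv0_eq.
by rewrite -J0 memv_cap Xa0 bcomb_in.
Qed.

Let zerosE : zeros M X = mq_zeros M J.
Proof.
apply/setP => n; apply/idP/mq_zerosP => [nX F FJ|J_n].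
  have [->|F0] := eqVneq F 0; first exact: (linear0 (mq_at M n)).
  have [a _ ->] := bcombP FJ F0; exact: mq_comb_zeros.
rewrite inE; apply/forallP => i; apply/eqP/J_n.
by apply: vbasis_mem; rewrite mem_nth // size_tuple.
Qed.

Lemma size_mq_zeros :
  `|(p ^ t * #|mq_zeros M J|)%:R / (p ^ (k * d))%:R - 1| <= s^-1.
Proof.
have [e [eD e0 e_norm e_neq1]] := additive_character R p_pr.
rewrite -zerosE.
exact: (card_zeros_dev_le p_pr eD e0 e_norm e_neq1 p_odd X_indep rank_ge).
Qed.

Lemma mq_zeros_neq0 : mq_zeros M J != set0.
Proof.
have [e [eD e0 e_norm e_neq1]] := additive_character R p_pr.
rewrite -zerosE.
exact: (zeros_neq0 p_pr eD e0 e_norm e_neq1 p_odd X_indep rank_ge).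
Qed.

(** If [F] is outside the span, no element of its coset has constant coefficient data: such a
    constant would be 0, by evaluation at a point of the nonempty zero set, and [F] would lie in the
    span. Then [not_vanishing_on_zeros] applies. *)
Lemma vanishing_in_span F :
  (forall n, n \in mq_zeros M J -> mq_eval M F n = 0) -> F \in <<J>>%VS.
Proof.
have [e [eD e0 e_norm e_neq1]] := additive_character R p_pr.
move=> F0; apply/negPn/negP => nFJ.
apply: (not_vanishing_on_zeros p_pr eD e0 e_norm e_neq1 p_odd X_indep rank_ge
  (F := F)); last by rewrite zerosE.
move=> a; rewrite below0_nonconst; apply: contra nFJ => G0.
have [n nJ] := set0Pn _ mq_zeros_neq0.
have GE m : mq_eval M (mq_comb X a + F) m = mq_u (mq_comb X a + F).
  exact: eval_below0.
have u0 : mq_u (mq_comb X a + F) = 0.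
  rewrite -(GE n) -[LHS]/(mq_at M n _) linearD /= /mq_at F0 // addr0.
  by apply: mq_comb_zeros; rewrite zerosE.
have : mq_comb X a + F = 0.
  have [v0 b0] := (below_mxP _ _).1 G0.
  apply: mquadP => //; first by apply/matrixP => i j; rewrite b0 // linear0 mxE.
  by apply/row_matrixP => i; rewrite v0 // row0.
by move=> /eqP; rewrite addrC addr_eq0 => /eqP ->; rewrite memvN bcomb_in.
Qed.

End Sizes.

(** Both inclusions come from [vanishing_in_span]. The second use is possible because [<<J>>], once
    known to lie in [<<Fs>>], inherits the absence of constants and the rank bound. *)
Lemma consistent_span_eq (R : rcfType) (p d k : nat) (M : quadform p d)
    (J Fs : seq (mquad p d k)) : prime p -> p != 2%N ->
  (<<Fs>> :&: below p d k 0 = 0)%VS -> (2 * \dim <<Fs>> + 1 <= qf_rank M)%N ->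
  mq_zeros M Fs = mq_zeros M J -> <<J>>%VS = <<Fs>>%VS.
Proof.
move=> p_pr p_odd Fs0 rk eqZ.
have JFs : (<<J>> <= <<Fs>>)%VS.
  apply/subvP => F FJ; apply: (vanishing_in_span R p_pr p_odd Fs0 rk) => n.
  by rewrite eqZ => /mq_zerosP; apply.
apply/eqP; rewrite eqEsubv JFs /=; apply/subvP => F FFs.
apply: (vanishing_in_span R p_pr p_odd (M := M)) => [||n].
- by apply/eqP; rewrite -subv0 -Fs0 capvS.
- apply: leq_trans rk; rewrite leq_add2r leq_mul2l /=; exact: dimvS.
- by rewrite -eqZ => /mq_zerosP; apply.
Qed.

(** Each term is compared with [P / N]. The differences between [P / N] and the inverse of [#|X|]
    add up to the modulus of the sum of all [m x - P], divided by [N], so they cost no more than the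
    first part. *)
Lemma sum_dev_le (R : realFieldType) (T : finType) (X : {set T}) (m : T -> nat)
    (P N : R) : (0 < \sum_(x in X) m x)%N -> N = (\sum_(x in X) m x)%:R ->
  \sum_(x in X) `|(m x)%:R / N - (#|X|%:R)^-1| <=
  2 * (\sum_(x in X) `|(m x)%:R - P|) / N.
Proof.
move=> N_gt0 NE; have N0 : 0 < N by rewrite NE ltr0n.
have X0 : 0 < #|X|%:R :> R.
  rewrite ltr0n card_gt0; apply: contraTneq N_gt0 => ->; by rewrite big_set0.
have N_sum : N = \sum_(x in X) (m x)%:R by rewrite NE natr_sum.
have dev x : `|(m x)%:R / N - (#|X|%:R)^-1| <=
    `|(m x)%:R - P| / N + `|P / N - (#|X|%:R)^-1|.
  have -> : (m x)%:R / N - (#|X|%:R)^-1 =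
      ((m x)%:R - P) / N + (P / N - (#|X|%:R)^-1) by rewrite mulrBl addrA subrK.
  apply: le_trans (ler_normD _ _) _; rewrite normrM [`|N^-1|]ger0_norm //.
  by rewrite invr_ge0 ltW.
apply: le_trans (ler_sum _ (fun x _ => dev x)) _.
rewrite big_split /= -mulr_suml sumr_const.
have -> : `|P / N - (#|X|%:R)^-1| *+ #|X| = `|\sum_(x in X) ((m x)%:R - P)| / N.
  have -> : \sum_(x in X) ((m x)%:R - P) =
      - ((P / N - (#|X|%:R)^-1) * (#|X|%:R * N)).
    rewrite sumrB -N_sum sumr_const -[P *+ _]mulr_natl; field.
    by rewrite !gt_eqF.
  rewrite normrN normrM [`|_ * N|]gtr0_norm ?mulr_gt0 // -[`|_| *+ _]mulr_natl.
  rewrite mulrA mulfK ?gt_eqF //.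
  by rewrite mulrC.
rewrite -mulrA mulr_natl mulr2n lerD2l ler_pM2r ?invr_gt0 //.
exact: ler_norm_sum.
Qed.

Lemma expfz_subn (F : fieldType) (x : F) (m n : nat) :
  x != 0 -> x ^ (m%:Z - n%:Z) = x ^+ m / x ^+ n.
Proof. by move=> x0; rewrite expfzDr // -exprnP -invr_expz -exprnP. Qed.

Lemma dim_standard (p d k : nat) (V : {vspace mquad p d k}) (rs : 'I_k -> nat) :
  (forall c, \dim (V :&: below p d k c) = \sum_(i < k | i < c) rs i)%N ->
  \dim V = (\sum_(i < k) rs i)%N.
Proof.
move=> /(_ k); have -> : (V :&: below p d k k)%VS = V.
  apply/capv_idPl/subvP => F _; apply/belowP => i.
  by rewrite leqNgt ltn_ord.
by move=> ->; apply: eq_bigl => i; rewrite ltn_ord.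
Qed.

Lemma standard_below0 (p d k : nat) (V : {vspace mquad p d k}) (rs : 'I_k -> nat) :
  (forall c, \dim (V :&: below p d k c) = \sum_(i < k | i < c) rs i)%N ->
  (V :&: below p d k 0 = 0)%VS.
Proof. by move=> /(_ 0%N) V0; apply/eqP; rewrite -dimv_eq0 V0 big_pred0. Qed.

(* The summand 4 * 2 ^ r makes the bounds trivial for p = 2. *)
Definition bound_cst (r : nat) : nat := (15 + 4 * 2 ^ r)%N.

Section Bounds.
Variables (R : realType) (p : nat).
Hypothesis p_pr : prime p.
Local Notation s := (Num.sqrt p%:R : R).

Lemma sqrt_gt0 : 0 < s. Proof. by rewrite sqrtr_gt0 ltr0n prime_gt0. Qed.

Lemma bound_cst_odd r : 15 / s <= (bound_cst r)%:R / s.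
Proof. by rewrite ler_pM2r ?invr_gt0 ?sqrt_gt0 // ler_nat leq_addr. Qed.

Lemma bound_cst_two r : p = 2%N -> (2 * 2 ^ r)%:R <= (bound_cst r)%:R / s.
Proof.
move=> p2; rewrite ler_pdivlMr ?sqrt_gt0 //.
have s2 : s <= 2.
  rewrite -[X in _ <= X](ger0_norm (ler0n _ 2)) -sqrtr_sqr ler_wsqrtr // p2.
  by rewrite -natrX ler_nat.
apply: le_trans (ler_wpM2l (ler0n _ _) s2) _; rewrite -natrM ler_nat /bound_cst.
by rewrite mulnC mulnA leq_addl.
Qed.

Lemma size_estimate (d k r : nat) (M : quadform p d) (J : seq (mquad p d k)) :
  (<<J>> :&: below p d k 0 = 0)%VS -> (\dim <<J>> <= r)%N ->
  (2 * r + 1 <= qf_rank M)%N ->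
  `|#|mq_zeros M J|%:R / p%:R ^ ((d * k)%:Z - (\dim <<J>>)%:Z) - 1| <=
  (bound_cst r)%:R / s :> R.
Proof.
move=> J0 dimJ rk; have p0 : p%:R != 0 :> R by rewrite pnatr_eq0 -lt0n prime_gt0.
rewrite expfz_subn // [(d * k)%N]mulnC invf_div mulrA [_ * p%:R ^+ _]mulrC.
rewrite -!natrX -natrM.
have [p2|p_odd] := eqVneq p 2%N; last first.
  apply: le_trans (bound_cst_odd r).
  apply: le_trans (size_mq_zeros R p_pr p_odd J0 _) _.
    by apply: leq_trans rk; rewrite leq_add2r leq_mul2l dimJ orbT.
  by rewrite ler_peMl ?invr_ge0 ?ler1n ?ltW ?sqrt_gt0.
apply: le_trans (bound_cst_two r p2).
(* For p = 2 the ratio lies between 0 and [2 ^ r], a range that the constant covers. *)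
set z := _ / _; have z0 : 0 <= z by rewrite divr_ge0 ?ler0n.
have zle : z <= (2 ^ r)%:R.
  rewrite ler_pdivrMr ?ltr0n ?expn_gt0 ?prime_gt0 // -natrM ler_nat.
  rewrite leq_mul //; first by rewrite -p2 leq_pexp2l ?prime_gt0.
  by rewrite -(card_matrix_Fp p_pr) max_card.
have r1 : 1 <= (2 ^ r)%:R :> R by rewrite ler1n expn_gt0.
rewrite ler_norml natrM; apply/andP; split; lra.
Qed.

End Bounds.

(** * Averages over a zero set and over its fibres *)

Section Averages.
Variable R : realType.
Local Open Scope complex_scope.

Lemma norm_avg_le1 (T : finType) (S : {set T}) (f : T -> R[i]) :
  (forall x, x \in S -> `|f x| <= 1) -> `|avg S f| <= 1.
Proof.
move=> f1; rewrite /avg normrM normfV normr_nat.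
have [->|S0] := eqVneq S set0; first by rewrite cards0 invr0 mul0r.
rewrite mulrC ler_pdivrMr ?ltr0n ?card_gt0 // mul1r.
apply: le_trans (ler_norm_sum _ _ _) _; rewrite -sum1_card natr_sum.
exact: ler_sum.
Qed.

Variables (p d k : nat) (M : quadform p d) (I : {set 'I_k}).
Variables (J J' J'' : seq (mquad p d k)).
Hypothesis dec : I_decomposition I J J' J''.
Local Notation Omega := (mq_zeros M J).
Local Notation OmegaI := (proj_set M I J').
Local Notation fiber := (fiber_set M J'').

Lemma sum_zeros_glue (V : nmodType) (f : 'M['F_p]_(k, d) -> V) :
  \sum_(n in Omega) f n = \sum_(x in OmegaI) \sum_(y in fiber x) f (glue x y).
Proof.
rewrite big_mkcond (sum_glue I) [RHS]big_mkcond; apply: eq_bigr => x _.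
have [xI|xI] := boolP (x \in OmegaI).
  rewrite [RHS]big_mkcond; apply: eq_bigr => y _.
  by rewrite (decomposition_zeros M dec) xI.
by apply: big1 => y _; rewrite (decomposition_zeros M dec) (negPf xI).
Qed.

Lemma card_zeros_glue : #|Omega| = (\sum_(x in OmegaI) #|fiber x|)%N.
Proof.
rewrite -sum1_card (sum_zeros_glue (fun _ => 1%N)).
by apply: eq_bigr => x _; rewrite sum1_card.
Qed.

(** The two averages differ only in the weight given to each fibre: its share of the total size on
    the one side, the uniform weight on the other. *)
Lemma avg_glue_le (f : 'M['F_p]_(k, d) -> R[i]) :
  (forall n, n \in Omega -> `|f n| <= 1) ->
  `|avg Omega f - avg OmegaI (fun x => avg (fiber x) (fun y => f (glue x y)))| <=
  (\sum_(x in OmegaI) `|#|fiber x|%:R / #|Omega|%:R - (#|OmegaI|%:R)^-1|)%:C.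
Proof.
move=> f1; rewrite /avg sum_zeros_glue !mulr_sumr -sumrB rmorph_sum /=.
apply: le_trans (ler_norm_sum _ _ _) _; apply: ler_sum => x xI.
rewrite mulrA -mulrBl normrM.
(* An empty fibre contributes 0 to both averages, the inverse of 0 being 0. *)
have [m0|m0] := eqVneq #|fiber x| 0%N.
  have -> : \sum_(y in fiber x) f (glue x y) = 0.
    by apply: big1 => y yF; rewrite (card0_eq m0) in yF.
  by rewrite normr0 mulr0 -[0](rmorph0 (real_complex R)) lecR.
have f_le : `|\sum_(y in fiber x) f (glue x y)| <= #|fiber x|%:R.
  apply: le_trans (ler_norm_sum _ _ _) _.
  rewrite -[X in _ <= X%:R]sum1_card natr_sum.
  apply: ler_sum => y yF; apply: f1.
  by rewrite (decomposition_zeros M dec) xI.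
apply: le_trans (ler_wpM2l (normr_ge0 _) f_le) _.
rewrite -[X in _ * X]normr_nat -normrM mulrBl -mulrA mulVf ?pnatr_eq0 // mulr1.
rewrite [X in `|X - _|]mulrC.
have normC (z : R) : `|z%:C| = `|z|%:C.
  by rewrite normc_def /= expr0n addr0 sqrtr_sqr.
by rewrite -normC rmorphB rmorphM /= !fmorphV /= !rmorph_nat.
Qed.

End Averages.

Lemma map_nondegenerate (p d k m : nat) (f : {linear mquad p d k -> mquad p d m})
    (J : seq (mquad p d k)) :
  (forall F, F \in <<J>>%VS -> f F \in below p d m 0 -> F = 0) ->
  (<<map f J>> :&: below p d m 0 = 0)%VS /\ \dim <<map f J>> = \dim <<J>>.
Proof.
move=> f0; rewrite span_map_linear; split.
  apply/eqP; rewrite -subv0; apply/subvP => G; rewrite memv_cap.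
  case/andP => /memv_imgP[F FJ ->]; rewrite lfunE /= => /(f0 _ FJ) ->.
  by rewrite linear0 mem0v.
apply: limg_dim_eq; apply/eqP; rewrite -subv0; apply/subvP => F.
rewrite memv_cap memv_ker lfunE /= => /andP[FJ /eqP fF].
by rewrite (f0 F FJ) ?fF ?mem0v.
Qed.

Lemma sub_in_below0 (p d k : nat) (M : quadform p d) (I : {set 'I_k}) F :
  (forall j, j \notin I -> ~~ mq_depends F j) ->
  sub_in M I F \in below p d #|I| 0 -> F \in below p d k 0.
Proof.
move=> indep /below_mxP[v0 b0].
have bE a b : mq_bmx (sub_in M I F) a b = mq_bmx F (enum_val a) (enum_val b).
  by rewrite mq_bmx_sub; [rewrite [LHS]mxE | exact: enum_val_mono].
have vE a : row a (mq_v (sub_in M I F)) = row (enum_val a) (mq_v F).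
  by apply/rowP => l; rewrite [LHS]mxE [LHS]mxE [RHS]mxE mulmx0 mul0mx addr0.
apply/below_mxP; split=> [i _|i j _].
  have [iI|/indep/mq_depends0P[] //] := boolP (i \in I).
  by rewrite -(enum_rankK_in iI iI) -vE v0.
have [iI|/indep/mq_depends0P[_ bi _]] := boolP (i \in I); last exact: bi.
have [jI|/indep/mq_depends0P[_ _ bj]] := boolP (j \in I); last exact: bj.
by rewrite -(enum_rankK_in iI iI) -(enum_rankK_in jI jI) -bE b0.
Qed.

(** Source of the constant 15: [D] is at most 3 [PI * PJ / s], and 2 times 3 divided by 2/5 is 15.
    The 2/5 is 1 - 3/5, where 3/5 bounds p^(-1/2) for p at least 3. *)
Lemma deviation_real (R : realFieldType) (s N NI PI PJ D : R) :
  0 < s -> 0 < PI -> 0 < PJ -> NI <= 2 * PI -> 2 / 5 * (PI * PJ) <= N ->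
  D <= NI * (PJ / s) + PI * PJ / s -> 2 * D / N <= 15 / s.
Proof.
move=> s0 PI0 PJ0 NIle Nge Dle; have PP := mulr_gt0 PI0 PJ0.
have N0 : 0 < N by lra.
rewrite ler_pdivrMr // mulrAC ler_pdivlMr //.
have Ds : D * s <= NI * PJ + PI * PJ.
  rewrite -ler_pdivlMr //; apply: le_trans Dle _.
  by rewrite mulrDl mulrA.
have NP : NI * PJ <= 2 * (PI * PJ) by rewrite mulrA ler_pM2r.
rewrite -mulrA; move: (D * s) (NI * PJ) (PI * PJ) Ds NP Nge => x y z; lra.
Qed.

Lemma dev_bounds (R : realFieldType) (z P e : R) : 0 < P ->
  `|z / P - 1| <= e -> (1 - e) * P <= z <= (1 + e) * P.
Proof.
move=> P0; rewrite ler_norml => /andP[le1 le2]; apply/andP; split.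
  by rewrite -ler_pdivlMr //; lra.
by rewrite -ler_pdivrMr //; lra.
Qed.

Lemma norm_sub_le_add (R : realDomainType) (m q P y : R) :
  0 <= m -> m <= q -> 0 <= P -> P <= q -> 0 <= y -> `|m - P| <= y + q.
Proof. by move=> *; rewrite ler_norml; apply/andP; split; lra. Qed.

Lemma norm_sub_le_mul (R : realDomainType) (m P e : R) :
  (1 - e) * P <= m <= (1 + e) * P -> `|m - P| <= P * e.
Proof.
by move=> /andP[? ?]; rewrite ler_norml; apply/andP; split; lra.
Qed.

Lemma inv_le_of_sqr (R : realFieldType) (s : R) :
  0 < s -> 3 <= s ^+ 2 -> s^-1 <= 3 / 5.
Proof. by move=> s0 s3; rewrite -[s^-1]mul1r ler_pdivrMr //; nra. Qed.

(** Outside the exceptional set [E] the fibres have size within [PJ / s] of [PJ]. On [E] the trivial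
    bound [PJ * p ^ t2] is used, and the rank hypothesis makes [p ^ t2 * #|E|] at most [PI / s]. *)
Lemma fiber_deviation (R : realType) (p d k r : nat) (M : quadform p d)
    (I : {set 'I_k}) (J J' J'' : seq (mquad p d k)) :
  prime p -> p != 2%N -> I_decomposition I J J' J'' ->
  (<<J>> :&: below p d k 0 = 0)%VS -> \dim <<J>> = r ->
  (2 * r + 1 <= qf_rank M)%N ->
  \sum_(x in proj_set M I J')
    `|#|fiber_set M J'' x|%:R / #|mq_zeros M J|%:R - (#|proj_set M I J'|%:R)^-1|
  <= 15 / Num.sqrt p%:R :> R.
Proof.
move=> p_pr p_odd dec J0 dimJ rk.
have [_ _ indep dep] := dec; have dimD := decomposition_dim dec.
set s := Num.sqrt p%:R; have s0 : 0 < s by exact: sqrt_gt0.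
have p0 : 0 < p%:R :> R by rewrite ltr0n prime_gt0.
have pX m : 0 < (p ^ m)%:R :> R by rewrite ltr0n expn_gt0 prime_gt0.
have ss : s ^+ 2 = p%:R by rewrite sqr_sqrtr ?ler0n.
have p_ge3 : 3 <= p%:R :> R.
  by rewrite ler_nat ltn_neqAle eq_sym p_odd prime_gt1.
have is_le : s^-1 <= 3 / 5 by apply: inv_le_of_sqr; rewrite ?ss.
pose t1 := \dim <<J'>>; pose t2 := \dim <<J''>>.
pose a := (#|I| * d)%N; pose b := (#|~: I| * d)%N.
have abE : (k * d = a + b)%N by rewrite -mulnDl cardsC card_ord.
have tE : (t1 + t2 = r)%N by rewrite dimD.
pose PI : R := (p ^ a)%:R / (p ^ t1)%:R; pose PJ : R := (p ^ b)%:R / (p ^ t2)%:R.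
have PI0 : 0 < PI by rewrite divr_gt0.
have PJ0 : 0 < PJ by rewrite divr_gt0.
have rk_le t : (t <= r)%N -> (2 * t + 1 <= qf_rank M)%N.
  by move=> tr; apply: leq_trans rk; rewrite leq_add2r leq_mul2l tr orbT.
have dev (z : R) t m : (p ^ t)%:R * z / (p ^ m)%:R = z / ((p ^ m)%:R / (p ^ t)%:R).
  by rewrite invf_div mulrCA mulrA.
have [Jin0 dimJin] : (<<[seq sub_in M I F | F <- J']>> :&: below p d #|I| 0 = 0)%VS /\
    \dim <<[seq sub_in M I F | F <- J']>> = t1.
  apply: (map_nondegenerate (f := sub_in M I)) => F FJ F0; apply: memv0_eq.
  rewrite -J0 memv_cap (subvP (decomposition_subl dec)) //=.
  exact: sub_in_below0 (indep _ FJ) F0.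
have NI_bounds : (1 - s^-1) * PI <= #|proj_set M I J'|%:R <= (1 + s^-1) * PI.
  apply: dev_bounds => //; rewrite -dev -natrM proj_set_zeros.
    rewrite -/a -dimJin; apply: size_mq_zeros => //.
    by rewrite dimJin rk_le // -tE leq_addr.
  by move=> F FJ; apply: indep; exact: memv_span.
have N_bounds : (1 - s^-1) * (PI * PJ) <= #|mq_zeros M J|%:R <= (1 + s^-1) * (PI * PJ).
  have -> : PI * PJ = (p ^ (k * d))%:R / (p ^ r)%:R.
    by rewrite abE -tE !expnD !natrM invfM mulrACA.
  apply: dev_bounds; rewrite ?divr_gt0 // -dev -natrM -dimJ.
  by apply: size_mq_zeros => //; rewrite dimJ.
have [E [cardE goodE]] := exceptional_set M p_pr dep.
have N_gt0 : (0 < \sum_(x in proj_set M I J') #|fiber_set M J'' x|)%N.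
  rewrite -(card_zeros_glue M dec) card_gt0.
  by apply: (mq_zeros_neq0 R p_pr p_odd J0); rewrite dimJ.
apply: le_trans (sum_dev_le PJ N_gt0 _) _.
  by rewrite (card_zeros_glue M dec).
apply: (deviation_real s0 PI0 PJ0 (NI := #|proj_set M I J'|%:R)).
- case/andP: NI_bounds => _ /le_trans; apply.
  by rewrite ler_pM2r //; clear -is_le; lra.
- case/andP: N_bounds => + _; apply: le_trans.
  by rewrite (ler_pM2r (mulr_gt0 PI0 PJ0)); clear -is_le; lra.
have dev_x x : `|#|fiber_set M J'' x|%:R - PJ| <=
    PJ / s + (x \in E)%:R * (PJ * (p ^ t2)%:R).
  have [xE|xE] := boolP (x \in E).
    rewrite mul1r divfK ?gt_eqF //.
    have m_le : #|fiber_set M J'' x|%:R <= (p ^ b)%:R :> R.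
      by rewrite ler_nat -(card_matrix_Fp p_pr) max_card.
    have PJ_le : PJ <= (p ^ b)%:R.
      by rewrite ler_pdivrMr // ler_peMr ?ler0n // ler1n expn_gt0 prime_gt0.
    by apply: norm_sub_le_add => //; rewrite ?ler0n ?divr_ge0 ?ltW.
  rewrite mul0r addr0.
  have [Jx0 dimJx] : (<<[seq sub_out M x F | F <- J'']>> :&: below p d #|~: I| 0 = 0)%VS
      /\ \dim <<[seq sub_out M x F | F <- J'']>> = t2.
    by apply: (map_nondegenerate (f := sub_out M x)) => F FJ; exact: goodE.
  have : (1 - s^-1) * PJ <= #|fiber_set M J'' x|%:R <= (1 + s^-1) * PJ.
    apply: dev_bounds => //; rewrite -dev -natrM fiber_set_zeros.
    rewrite -/b -dimJx; apply: size_mq_zeros => //.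
    by rewrite dimJx rk_le // -tE leq_addl.
  exact: norm_sub_le_mul.
apply: le_trans (ler_sum _ (fun x _ => dev_x x)) _.
rewrite big_split /= sumr_const -[_ *+ #|proj_set M I J'|]mulr_natl lerD2l.
rewrite -mulr_suml mulrCA (_ : PI * PJ / s = PJ * (PI / s)); last first.
  by rewrite [PI * PJ]mulrC -mulrA.
rewrite (ler_pM2l PJ0) mulrC.
have sumE : \sum_(x in proj_set M I J') (x \in E)%:R <= #|E|%:R :> R.
  rewrite -natr_sum ler_nat -[leqRHS]sum1_card [leqRHS]big_mkcond /=.
  rewrite [leqLHS]big_mkcond; apply: leq_sum => x _.
  by case: (x \in proj_set _ _ _); case: (x \in E).
apply: le_trans (ler_wpM2l (ler0n _ _) sumE) _.
(* Replacing [s] by p turns the claim into a comparison of powers of p, namely 2 t2 + t1 + 1 <=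
   rank(A). *)
have s_le : s <= p%:R.
  rewrite -ss expr2 ler_peMr ?(ltW s0) // -invf_le1 //; clear -is_le; lra.
rewrite ler_pdivlMr // ler_pdivlMr //.
apply: le_trans (_ : (p ^ t2 * #|E|)%:R * p%:R * (p ^ t1)%:R <= _).
  by rewrite natrM ler_pM2r // ler_wpM2l ?mulr_ge0 ?ler0n.
rewrite -!natrM ler_nat -(leq_pmul2r (_ : 0 < p ^ qf_rank M)%N); last first.
  by rewrite expn_gt0 prime_gt0.
apply: leq_trans (_ : p ^ t2 * p * p ^ t1 * (p ^ t2 * p ^ a) <= _)%N.
  rewrite [(_ * #|E| * p)%N]mulnAC [(_ * #|E| * _)%N]mulnAC -[leqLHS]mulnA.
  by rewrite leq_mul2l cardE orbT.
rewrite [leqRHS]mulnC mulnA leq_mul2r; apply/orP; right.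
rewrite -expnSr -!expnD leq_pexp2l ?prime_gt0 //; apply: leq_trans rk.
rewrite -tE mul2n -addnn addn1 !addSn ltnS [(t2 + t1)%N]addnC leq_add2l.
exact: leq_addl.
Qed.

Local Open Scope complex_scope.

Theorem theoremC3 (R : realType) (k r : nat) (k_gt0 : (0 < k)%N) :
  exists K : R,
  forall (d p : nat) (rs : 'I_k -> nat) (M : quadform p d)
         (Omega : {set 'M['F_p]_(k, d)}),
    (0 < d)%N -> prime p -> (\sum_(i < k) rs i = r)%N ->
    (2 * r + 1 <= qf_rank M)%N ->
    consistent_Mset M Omega -> has_standard_rep M Omega rs ->
  (* (i) *)
  (`| #|Omega|%:R / p%:R ^ ((d * k)%:Z - r%:Z) - 1 | <= K / Num.sqrt p%:R)
  /\
  (* Omega_I and Omega_I(x) are formed from any consistent family J with zero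
     set Omega and any I-decomposition of J; for p = 2, where different J may
     give different sets, J is a standard representation of Omega. *)
  (forall (J : seq (mquad p d k)),
     consistent M J -> Omega = mq_zeros M J -> (p = 2%N -> standard J rs) ->
   (* (ii) *)
   (forall (k' : nat) (J' J'' : seq (mquad p d k)),
      let I := [set i : 'I_k | (i < k')%N] in
      (1 <= k')%N -> (k' <= k - 1)%N ->
      I_decomposition I J J' J'' ->
      let OmegaI := proj_set M I J' in
      let OmegaIx := fiber_set M J'' in
      let r' := (\max_(i < k | (k' <= i)%N) rs i)%N in
      [/\ consistent_Mset M OmegaI,
          has_standard_rep M OmegaI (fun a => rs (enum_val a))
        & exists E : {set 'M['F_p]_(#|I|, d)},
            (#|E|%:R : R) <= (k - k')%:R * r'%:R *
               p%:R ^ ((d * k')%:Z + r'%:Z - 1 - (qf_rank M)%:Z) /\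
            forall x, x \notin E ->
              has_standard_rep M (OmegaIx x) (fun b => rs (enum_val b)) /\
              `| #|OmegaIx x|%:R /
                   p%:R ^ ((d * (k - k'))%:Z
                           - (\sum_(i < k | (k' <= i)%N) rs i)%:Z) - 1 |
                <= K / Num.sqrt p%:R]) /\
   (* (iii) *)
   (forall (I : {set 'I_k}) (J' J'' : seq (mquad p d k)),
      (2 <= k)%N -> I != set0 -> ~: I != set0 ->
      I_decomposition I J J' J'' ->
      forall f : 'M['F_p]_(k, d) -> R[i],
        (forall n, n \in Omega -> `|f n| <= 1) ->
        `| avg Omega f
           - avg (proj_set M I J')
               (fun x => avg (fiber_set M J'' x) (fun y => f (glue x y))) |
          <= (K / Num.sqrt p%:R)%:C)).
Proof.
exists (bound_cst r)%:R => d p rs M Omega _ p_pr sum_rs rk _ [Fs stF OmegaE].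
have dimFs c := standard_dim c stF.
have Fs0 := standard_below0 dimFs.
have dF : \dim <<Fs>> = r by rewrite (dim_standard dimFs).
split.
  by rewrite OmegaE -dF; apply: size_estimate; rewrite ?dF.
move=> J consJ OmegaJ stJ2.
(* For odd p the span of [J] is that of the given standard representation; for p = 2 the family [J]
   is standard itself. *)
have dimJ c : \dim (<<J>> :&: below p d k c) = (\sum_(i < k | i < c) rs i)%N.
  have [p2|p_odd] := eqVneq p 2%N; first exact: standard_dim (stJ2 p2).
  rewrite (consistent_span_eq R p_pr p_odd Fs0 (M := M)) ?dF //.
  by rewrite -OmegaE.
have J0 := standard_below0 dimJ.
have dJ : \dim <<J>> = r by rewrite (dim_standard dimJ).
split=> [k' J' J'' I k'_gt0 k'_le dec OmegaI OmegaIx r'|I J' J'' _ _ _ dec f f_le].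
  have k'_lt : (k' < k)%N by rewrite (leq_ltn_trans k'_le) // subn1 prednK.
  have cardI : #|I| = k'.
    have := card_ord k'; rewrite -sum1_card => <-.
    rewrite -sum1_card (big_ord_widen k (fun _ => 1%N)) ?(ltnW k'_lt) //.
    by apply: eq_bigl => i; rewrite inE.
  have cardO : #|~: I| = (k - k')%N.
    by rewrite cardsCs setCK cardI card_ord.
  split; [exact: consistent_proj dec consJ | exact: has_standard_proj dec dimJ |].
  have [E [cardE goodE]] := exceptional_initial M p_pr dec dimJ.
  exists E; split=> [|x xE].
    have {}cardE : (#|E| * p ^ qf_rank M <=
        (k - k') * (r' * p ^ r'.-1 * p ^ (d * k')))%N.
      by apply: leq_trans cardE _; rewrite cardO cardI [(k' * d)%N]mulnC.
    (* For [r' = 0] the truncated exponent [r'.-1] is not r' - 1, but the factor [r'] makes both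
       bounds 0. *)
    case: (r') cardE => [|m] cardE.
      move: cardE; rewrite !mul0n muln0 leqn0 muln_eq0 => /orP[/eqP ->|].
        by rewrite mulr0 mul0r.
      by rewrite eqn0Ngt expn_gt0 prime_gt0.
    have p0 : p%:R != 0 :> R by rewrite pnatr_eq0 -lt0n prime_gt0.
    have -> : (d * k')%:Z + m.+1%:Z - 1 - (qf_rank M)%:Z =
        (d * k' + m)%N%:Z - (qf_rank M)%:Z by rewrite -addn1 !PoszD addrA addrK.
    rewrite expfz_subn // -!natrX mulrA ler_pdivlMr ?ltr0n ?expn_gt0 ?prime_gt0 //.
    rewrite -!natrM ler_nat; apply: leq_trans cardE _.
    by rewrite expnD [(p ^ _ * p ^ m)%N]mulnC !mulnA.
  have [Fx stFx FxE] := goodE x xE; split; first by exists Fx.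
  have dimFx c := standard_dim c stFx.
  have sum_out : (\sum_(i < k | k' <= i) rs i = \sum_(b < #|~: I|) rs (enum_val b))%N.
    rewrite -big_enum_val; apply: eq_bigl => i.
    by rewrite !inE -leqNgt.
  have dFx := dim_standard dimFx.
  rewrite /OmegaIx FxE -cardO sum_out -dFx.
  apply: size_estimate => //; first exact: standard_below0 dimFx.
  rewrite dFx -sum_out -sum_rs big_mkcond leq_sum // => i _.
  by case: ifP.
(* For p = 2 both averages have modulus at most 1, and the constant is large enough to cover their
   difference. *)
have [p2|p_odd] := eqVneq p 2%N; last first.
  rewrite OmegaJ in f_le *; apply: le_trans (avg_glue_le dec f_le) _.
  rewrite lecR; apply: le_trans (bound_cst_odd R p_pr r).
  exact: fiber_deviation p_pr p_odd dec J0 dJ rk.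
apply: le_trans (ler_normB _ _) _.
have f_le' x y : x \in proj_set M I J' -> y \in fiber_set M J'' x ->
    `|f (glue x y)| <= 1.
  move=> xI yF; apply: f_le.
  by rewrite OmegaJ (decomposition_zeros M dec) xI.
apply: le_trans (_ : 1 + 1 <= _).
  apply: lerD; first exact: norm_avg_le1.
  by apply: norm_avg_le1 => x xI; apply: norm_avg_le1 => y yF; exact: f_le'.
apply: le_trans (_ : (2 * 2 ^ r)%:R%:C <= _); last by rewrite lecR bound_cst_two.
rewrite rmorph_nat -[1 + 1]/(2%:R) ler_nat.
by rewrite leq_pmulr // expn_gt0.
Qed.
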